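(* Let $V$ be a $d\times d$ (symmetric) positive definite matrix with all diagonal entries equal to $1$, with largest and smallest eigenvalues $\lambda_{\max}$ and $\lambda_{\min}$. Let $\hat\kappa$ and $\hat\gamma$ be two positive constants with $\hat\gamma\le1$. Consider a real-valued Borel function $f$ of $d$ variables such that $$E\big((f(X)-f(X'))^2\big)\le\hat\kappa^2\big(E(\|X-X'\|^2)\big)^{\hat\gamma}$$ for any centered Gaussian column vector $\begin{pmatrix} X \\ X' \end{pmatrix}$ with $\operatorname{Cov}(X)\le V$ and $\operatorname{Cov}(X')\le V$, where $X$ and $X'$ have dimension $d$. For $i\ge0$ set $$\nu(i)=\hat\kappa^2\min\left((\lambda_{\max}d)^{\hat\gamma}\Big(1-\frac{\lambda_{\min}}{d}\Big)^{\hat\gamma i},\ \Big(\frac{d^2}{i+1}\Big)^{\hat\gamma}\right).$$ Then Assumption A1 (stated in the context) holds for the function $f$ and the Markov chain $(X_i)_{i\ge0}$ defined in the context, with this sequence $\nu$. That is, $(\nu(i))_{i\ge0}$ is a positive decreasing sequence with $\sum_{i=0}^\infty\sqrt{\nu(i)/(i+1)}<\infty$, and $$E\big((f(X_{i,m})-f(X_i))^2\big)\le\nu(i)\quad\text{for all integers } i,m\ge0 .$$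
   Context: $\|\cdot\|$ is the Euclidean norm, $\operatorname{Cov}$ is the covariance matrix, and $A\le B$ for symmetric matrices means $B-A$ is positive semidefinite. Gaussian vectors may be degenerate. Let $(e_i)_{i\in\mathbb Z}$ be i.i.d., each uniformly distributed on the $d$ standard basis column vectors of $\mathbb R^d$, and let $(g_i)_{i\in\mathbb Z}$ be i.i.d. standard Gaussian real random variables, independent of $(e_i)_{i\in\mathbb Z}$. The Markov chain $(X_i)_{i\ge0}$ of $d$-dimensional column vectors is given by $X_0=0$ and $$X_{i+1}=X_i+(g_i-e_i^TX_i)(Ve_i),\quad i\ge0.$$ For an integer $m\ge0$, the shifted chain $(X_{i,m})_{i\ge-m}$ is given by $X_{-m,m}=0$ and $X_{i+1,m}=X_{i,m}+(g_i-e_i^TX_{i,m})(Ve_i)$ for $i\ge-m$ (driven by the same $g_i,e_i$). Assumption A1 for $f$ and the chain, with a sequence $(\nu(i))_{i\ge0}$: the sequence is positive and decreasing, $\sum_{i=0}^\infty\sqrt{\nu(i)/(i+1)}<\infty$, and $E((f(X_{i,m})-f(X_i))^2)\le\nu(i)$ for all integers $i,m\ge0$.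
   Formalization: For d = 1 one has λ_min = 1, so ν(i) = 0 for i ≥ 1 and ν is not positive; the formal theorem proves A1 with ν positive and strictly decreasing for d ≥ 2, and for d = 1 with ν only nonnegative and nonincreasing. *)

(* Defs.v *)
From HB Require Import structures.
From mathcomp Require Import all_boot all_order all_algebra.
From mathcomp Require Import all_classical all_reals all_analysis.

Set Implicit Arguments.
Unset Strict Implicit.
Unset Printing Implicit Defensive.

Import Order.TTheory GRing.Theory Num.Theory.
Import numFieldNormedType.Exports.

Local Open Scope classical_set_scope.
Local Open Scope ring_scope.

(** * Linear algebra in R^n *)

(* The norm `|x| that the library puts on matrices is the sup norm. *)
Definition euclidean_norm (R : realType) (n : nat) (x : 'cV[R]_n) : R :=
  Num.sqrt (\sum_(i < n) x i 0 ^+ 2).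

Definition quad_form (R : realType) (n : nat) (A : 'M[R]_n) (x : 'cV[R]_n) : R :=
  (x^T *m A *m x) 0 0.

Definition symmetric (R : realType) (n : nat) (A : 'M[R]_n) : Prop := A^T = A.

Definition positive_definite (R : realType) (n : nat) (A : 'M[R]_n) : Prop :=
  symmetric A /\ forall x : 'cV[R]_n, x != 0 -> 0 < quad_form A x.

Definition positive_semidefinite (R : realType) (n : nat) (A : 'M[R]_n) : Prop :=
  symmetric A /\ forall x : 'cV[R]_n, 0 <= quad_form A x.

Definition loewner_le (R : realType) (n : nat) (A B : 'M[R]_n) : Prop :=
  positive_semidefinite (B - A).

Definition largest_eigenvalue (R : realType) (n : nat) (A : 'M[R]_n) (l : R) : Prop :=
  eigenvalue A l /\ forall a : R, eigenvalue A a -> a <= l.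

Definition smallest_eigenvalue (R : realType) (n : nat) (A : 'M[R]_n) (l : R) : Prop :=
  eigenvalue A l /\ forall a : R, eigenvalue A a -> l <= a.

(** * Borel sets of R^n, random vectors, Gaussian vectors *)

(* Column vectors with the sigma-algebra generated by the open sets. *)
Definition borel_vec (R : realType) (n : nat) : measurableType _ :=
  g_sigma_algebraType (@open 'cV[R]_n).

Definition borel_function (R : realType) (n : nat) (f : 'cV[R]_n -> R) : Prop :=
  measurable_fun [set: borel_vec R n] (f : borel_vec R n -> R).

Definition random_vector (d : measure_display) (T : measurableType d)
    (R : realType) (n : nat) (X : T -> 'cV[R]_n) : Prop :=
  measurable_fun [set: T] (X : T -> borel_vec R n).

Definition has_law (d : measure_display) (T : measurableType d) (R : realType)
    (P : probability T R) (Y : T -> R) (mu : set R -> \bar R) : Prop :=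
  measurable_fun [set: T] Y /\
  forall B : set R, measurable B -> P (Y @^-1` B) = mu B.

(* The real Gaussian law of mean m and standard deviation s >= 0. The library's
   [normal_prob m 0] is not the Dirac mass at m, hence the case s = 0. *)
Definition gaussian_law (R : realType) (m s : R) : set R -> \bar R :=
  fun B => if s == 0 then \d_m B else normal_prob m s B.

(* Possibly degenerate: every linear combination of the coordinates is a
   possibly degenerate real Gaussian variable. *)
Definition gaussian_vector (d : measure_display) (T : measurableType d)
    (R : realType) (P : probability T R) (n : nat) (X : T -> 'cV[R]_n) : Prop :=
  random_vector X /\
  forall a : 'cV[R]_n, exists m s : R,
    0 <= s /\ has_law P (fun w => (a^T *m X w) 0 0) (gaussian_law m s).

Definition centered (d : measure_display) (T : measurableType d)
    (R : realType) (P : probability T R) (n : nat) (X : T -> 'cV[R]_n) : Prop :=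
  forall i : 'I_n, ('E_P[fun w => X w i 0%R] = 0)%E.

Definition Cov (d : measure_display) (T : measurableType d)
    (R : realType) (P : probability T R) (n : nat) (X : T -> 'cV[R]_n) : 'M[R]_n :=
  \matrix_(i < n, j < n)
    fine (covariance P (fun w => X w i 0) (fun w => X w j 0)).

(* Both sides are extended reals, so that an infinite left-hand side is excluded
   by the inequality. All probability spaces are allowed. *)
Definition gaussian_holder (R : realType) (n : nat) (V : 'M[R]_n)
    (kappa gamma : R) (f : 'cV[R]_n -> R) : Prop :=
  forall (d : measure_display) (T : measurableType d) (P : probability T R)
    (X X' : T -> 'cV[R]_n),
    gaussian_vector P (fun w => col_mx (X w) (X' w)) ->
    centered P (fun w => col_mx (X w) (X' w)) ->
    loewner_le (Cov P X) V -> loewner_le (Cov P X') V ->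
    ('E_P[(fun w => (f (X w) - f (X' w)) ^+ 2)%R] <=
     (kappa ^+ 2)%:E *
       ('E_P[(fun w => euclidean_norm (X w - X' w) ^+ 2)%R] `^ gamma))%E.

(** * Independence *)

Definition mutually_independent (d : measure_display) (T : measurableType d)
    (R : realType) (P : probability T R) (I : eqType)
    (d' : measure_display) (S : measurableType d') (X : I -> T -> S) : Prop :=
  forall (s : seq I) (B : I -> set S), uniq s ->
    (forall i, measurable (B i)) ->
    (P (\bigcap_(i in [set` s]) (X i @^-1` B i)) =
     \prod_(i <- s) P (X i @^-1` B i))%E.

Definition sigma_generated (d : measure_display) (T : measurableType d)
    (I : Type) (d' : measure_display) (S : measurableType d')
    (X : I -> T -> S) : set (set T) :=
  <<s [set A | exists (i : I) (B : set S), measurable B /\ A = X i @^-1` B] >>.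

Definition independent_families (d : measure_display) (T : measurableType d)
    (R : realType) (P : probability T R) (I J : Type)
    (d1 : measure_display) (S1 : measurableType d1) (X : I -> T -> S1)
    (d2 : measure_display) (S2 : measurableType d2) (Y : J -> T -> S2) : Prop :=
  forall A B : set T, sigma_generated X A -> sigma_generated Y B ->
    (P (A `&` B) = P A * P B)%E.

(** * The Markov chain *)

Record driving_sequences (d : measure_display) (T : measurableType d)
    (R : realType) (P : probability T R) (n : nat)
    (e : int -> T -> 'cV[R]_n) (g : int -> T -> R) : Prop := DrivingSequences {
  e_random : forall i, random_vector (e i);
  e_uniform : forall i (k : 'I_n),
    P [set w | e i w = delta_mx k 0] = ((n%:R)^-1)%:E;
  e_independent : mutually_independent P (e : int -> T -> borel_vec R n);
  g_standard : forall i, has_law P (g i) (normal_prob 0 1);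
  g_independent : mutually_independent P g;
  e_g_independent : independent_families P (e : int -> T -> borel_vec R n) g }.

(* State after k steps of the chain started from 0 at time s. *)
Fixpoint chain_from (T : Type) (R : realType) (n : nat) (V : 'M[R]_n)
    (e : int -> T -> 'cV[R]_n) (g : int -> T -> R) (s : int) (k : nat) (w : T)
    : 'cV[R]_n :=
  if k is k'.+1 then
    let i := s + k'%:Z in
    let x := chain_from V e g s k' w in
    x + (g i w - ((e i w)^T *m x) 0 0) *: (V *m e i w)
  else 0.

Definition chain (T : Type) (R : realType) (n : nat) (V : 'M[R]_n)
    (e : int -> T -> 'cV[R]_n) (g : int -> T -> R) (i : nat) : T -> 'cV[R]_n :=
  chain_from V e g 0 i.

(* X_{i,m}, for i >= 0: time i is reached after i + m steps from time -m. *)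
Definition shifted_chain (T : Type) (R : realType) (n : nat) (V : 'M[R]_n)
    (e : int -> T -> 'cV[R]_n) (g : int -> T -> R) (i m : nat) : T -> 'cV[R]_n :=
  chain_from V e g (- m%:Z) (i + m).

(** * Assumption A1 *)

Definition A1_summable (R : realType) (nu : nat -> R) : Prop :=
  (\sum_(0 <= i <oo) (Num.sqrt (nu i / i.+1%:R))%:E < +oo)%E.

Definition A1_bound (d : measure_display) (T : measurableType d)
    (R : realType) (P : probability T R) (n : nat) (f : 'cV[R]_n -> R)
    (X : nat -> T -> 'cV[R]_n) (Xs : nat -> nat -> T -> 'cV[R]_n)
    (nu : nat -> R) : Prop :=
  forall i m : nat,
    ('E_P[(fun w => (f (Xs i m w) - f (X i w)) ^+ 2)%R] <= (nu i)%:E)%E.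

(* [decreasing_seq] is strict. *)
Definition assumption_A1 (d : measure_display) (T : measurableType d)
    (R : realType) (P : probability T R) (n : nat) (f : 'cV[R]_n -> R)
    (X : nat -> T -> 'cV[R]_n) (Xs : nat -> nat -> T -> 'cV[R]_n)
    (nu : nat -> R) : Prop :=
  [/\ forall i, 0 < nu i, decreasing_seq nu, A1_summable nu
    & A1_bound P f X Xs nu].

(* A1 with "positive decreasing" read as "nonnegative nonincreasing"; this is
   all that [nu_bound] satisfies in dimension 1. *)
Definition weak_assumption_A1 (d : measure_display) (T : measurableType d)
    (R : realType) (P : probability T R) (n : nat) (f : 'cV[R]_n -> R)
    (X : nat -> T -> 'cV[R]_n) (Xs : nat -> nat -> T -> 'cV[R]_n)
    (nu : nat -> R) : Prop :=
  [/\ forall i, 0 <= nu i, nonincreasing_seq nu, A1_summable nu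
    & A1_bound P f X Xs nu].

(* For n = 1 the first term of the minimum is 0 as soon as i >= 1, because then
   V = 1 and lmin = 1; with the convention 0 `^ 0 = 1 it is positive at i = 0. *)
Definition nu_bound (R : realType) (n : nat) (lmax lmin kappa gamma : R)
    (i : nat) : R :=
  kappa ^+ 2 *
  Num.min ((lmax * n%:R) `^ gamma * (1 - lmin / n%:R) `^ (gamma * i%:R))
          ((n%:R ^+ 2 / i.+1%:R) `^ gamma).

(* Main.v *)
(* Write V = S S^T and X = S Y. Given the draws of the e_i, Y moves by
   y |-> P_j y + g v_j, where v_j = S^T e_j is a unit vector (V has unit diagonal)
   and P_j is the orthogonal projection onto the complement of v_j. So, given the
   draws, X_{i,m} and X_i are linear images S U g and S U' g of the same finite
   block of Gaussian noise, with U U^T <= 1 and U' U'^T <= 1. The hypothesis on f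
   applies for each of the finitely many words of draws, and Jensen's inequality
   for x^gamma reduces the claim to bounds on q_i = E |X_{i,m} - X_i|^2.

   Let Phi(A) be the average of P_j A P_j over j and Z = 1 - Phi(1) = S^T S / n.
   Then E (Y_{i,m} - Y_i)(Y_{i,m} - Y_i)^T = sum_(l < m) Phi^(i+l)(Z); let a_i be
   its trace. We have a_0 <= n and q_i = n (a_i - a_(i+1)). Since
   lmin a_i <= q_i <= lmax a_i, the a_i decay geometrically, which bounds q_i by
   lmax n (1 - lmin/n)^i. Moreover Phi is self-adjoint with Phi^2 <= Phi <= 1 for
   the Frobenius product, so q_i = n sum_(l < m) <Z, Phi^(i+l)(Z)> is nonincreasing,
   and telescoping gives (i+1) q_i <= n a_0 <= n^2. *)

Require Import Defs.
From HB Require Import structures.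
From mathcomp Require Import all_boot all_order all_algebra.
From mathcomp Require Import all_classical all_reals all_analysis.
From mathcomp Require Import measurable_realfun.
From mathcomp Require Import ring lra zify.

Set Implicit Arguments.
Unset Strict Implicit.
Unset Printing Implicit Defensive.

Import Order.TTheory GRing.Theory Num.Theory.
Import numFieldNormedType.Exports.

Local Open Scope classical_set_scope.
Local Open Scope ring_scope.

(** * Gaussian measures on the line *)

(** The map A |-> P_j A P_j is an orthogonal projection of the space of matrices, so Phi is an
    average of orthogonal projections. Hence <A, Phi(A)> is the mean of |P_j A P_j|^2, which is at
    most |A|^2 and, by convexity of the squared norm, at least |Phi(A)|^2. A step uses noise that
    has not been used before, so it turns U U^T into P_j U U^T P_j + v_j v_j^T. This preserves U U^T
    <= 1, since P_j + v_j v_j^T = 1, and averaged over j it reads A |-> Phi(A) + Z. Once both chains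
    run, the common noise cancels in their difference and only Phi acts; this is why just m powers
    of Phi appear. The law of X_i is a mixture of Gaussian laws and in general not Gaussian, while
    the hypothesis on f concerns Gaussian vectors only. So f can be compared only word by word, and
    the power gamma has to be averaged afterwards. Conditioning is carried out by splitting
    integrals over finitely many events, each independent of the noise, which cover the space up to
    a null set. *)

Section density.
Context d (T : measurableType d) (R : realType).
Local Open Scope ereal_scope.
Import HBNNSimple.

(** The hypothesis is the case of an indicator; simple functions follow by linearity, and [f] by
    monotone convergence. It is used both for normal densities and for restricting a measure to an
    event, where the density is an indicator. *)
Lemma ge0_integral_density (mu nu : {measure set T -> \bar R}) (p : T -> R)
    (f : T -> \bar R) : measurable_fun setT p -> (forall x, 0 <= p x)%R ->
    (forall B, measurable B -> nu B = \int[mu]_(x in B) (p x)%:E) ->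
    measurable_fun setT f -> (forall x, 0 <= f x) ->
  \int[nu]_x f x = \int[mu]_x (f x * (p x)%:E).
Proof.
move=> mp p0 nuE mf f0.
pose f_ := nnsfun_approx measurableT mf.
transitivity (limn (fun n => \int[nu]_x (f_ n x)%:E)).
  rewrite -monotone_convergence//=.
  - apply: eq_integral => x _; apply/esym/cvg_lim => //=.
    exact: cvg_nnsfun_approx.
  - by move=> n; exact/measurable_EFinP/measurable_funPT.
  - by move=> n x _; rewrite lee_fin.
  - by move=> x _ a b ab; rewrite lee_fin//; exact/lefP/nd_nnsfun_approx.
transitivity (limn (fun n => \int[mu]_x ((f_ n x)%:E * (p x)%:E))); last first.
  rewrite -monotone_convergence//=.
  - apply: eq_integral => x _; apply/cvg_lim => //=.
    apply: cvgeZr => //; exact: cvg_nnsfun_approx.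
  - by move=> n; apply/measurable_EFinP/measurable_funM.
  - by move=> n x _; rewrite lee_fin mulr_ge0.
  - move=> x _ a b ab; rewrite lee_fin// ler_wpM2r//.
    exact/lefP/nd_nnsfun_approx.
congr (limn _); apply/funext => n.
under eq_integral do rewrite fimfunE -fsumEFin//.
rewrite ge0_integral_fsum//; last 2 first.
  - by move=> r; exact/measurable_EFinP/measurableT_comp.
  - by move=> r x _; rewrite EFinM nnfun_muleindic_ge0.
under [RHS]eq_integral => x xE.
  rewrite fimfunE -fsumEFin // ge0_mule_fsuml => [|y]; last exact: nnfun_muleindic_ge0.
  over.
rewrite ge0_integral_fsum//; last 2 first.
  - move=> r; apply: emeasurable_funM; apply/measurable_EFinP => //.
    exact: measurable_funM.
  - by move=> r x _; rewrite mule_ge0 ?nnfun_muleindic_ge0// lee_fin.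
apply: eq_fsbigr => r rhn.
rewrite integralZl_indic_nnsfun// integral_indic//= setIT.
under [RHS]eq_integral do rewrite EFinM -muleA.
have [r0|r0] := ltP r 0%R.
  rewrite preimage_nnfun0//= measure0 mule0 integral0_eq// => x _.
  by rewrite indic0 mul0e mule0.
rewrite ge0_integralZl//; first last.
  - by move=> x _; rewrite mule_ge0// lee_fin.
  - by apply: emeasurable_funM; apply/measurable_EFinP.
congr (_ * _); rewrite nuE// integral_mkcond; apply: eq_integral => x _.
by rewrite epatch_indic muleC.
Qed.

End density.

(** * Scaling, convolution and second moment of normal laws *)

Section normal.
Context {R : realType}.
Implicit Types (s t c x y : R) (f : measurableTypeR R -> \bar R).
Local Notation mu := (@lebesgue_measure R).

Local Open Scope ereal_scope.

Lemma ge0_integral_normal_prob (m s : R) f : measurable_fun setT f ->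
    (forall x, 0 <= f x) ->
  \int[normal_prob m s]_x f x = \int[mu]_x (f x * (normal_pdf m s x)%:E).
Proof.
apply: ge0_integral_density => //; first exact: measurable_normal_pdf.
by move=> x; exact: normal_pdf_ge0.
Qed.

Lemma measurable_affine (a b : R) :
  measurable_fun [set: measurableTypeR R]
    ((fun x : R => a * x + b)%R : measurableTypeR R -> measurableTypeR R).
Proof. by apply: measurable_funD => //; exact: measurable_funM. Qed.

(** By uniqueness of Lebesgue measure, half-open intervals suffice. *)
Lemma lebesgue_measure_affine (a b : R) (A : set R) : a != 0%R ->
  measurable A ->
  mu A = `|a|%:E * mu ((fun x => a * x + b)%R @^-1` A).
Proof.
move=> a0 mA; pose k : {nonneg R} := NngNum (normr_ge0 a).
have mphi := measurable_affine a b.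
apply: (lebesgue_measure_unique
  (mu := mscale k (pushforward mu
    ((fun x => a * x + b)%R : measurableTypeR R -> measurableTypeR R)))) => //.
move=> _ [[u v]] _ <-.
rewrite /mscale/=.
change (mu `]u, v] = `|a|%:E * mu ((fun x : R => a * x + b)%R @^-1` `]u, v])).
have [a_gt0|a_lt0] : (0 < a)%R \/ (a < 0)%R by case: ltgtP a0; tauto.
- rewrite (_ : _ @^-1` _ = `](u - b) / a, (v - b) / a]%classic)%R; last first.
    apply/seteqP; split => x /=; rewrite !in_itv/= ltr_pdivrMr// ler_pdivlMr//;
      by rewrite ltrBlDr lerBrDr mulrC.
  rewrite !lebesgue_measure_itv/= !lte_fin ltr_pM2r ?invr_gt0// ltrD2r.
  case: ifPn => _; last by rewrite mule0.
  rewrite gtr0_norm// -!EFinB -EFinM; congr EFin; field.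
  by rewrite gt_eqF.
(* A negative slope swaps the closed and the open end, which does not change the length. *)
- rewrite (_ : _ @^-1` _ = `[(v - b) / a, (u - b) / a[%classic)%R; last first.
    apply/seteqP; split => x /=; rewrite !in_itv/= ltr_ndivlMr// ler_ndivrMr//;
      by rewrite ltrBlDr lerBrDr mulrC andbC.
  rewrite !lebesgue_measure_itv/= !lte_fin ltr_nM2r ?invr_lt0// ltrD2r.
  case: ifPn => _; last by rewrite mule0.
  rewrite ltr0_norm// -!EFinB -EFinM; congr EFin; field.
  by rewrite lt_eqF.
Qed.

Lemma ge0_integral_affine (a b : R) f : a != 0%R ->
  measurable_fun setT f -> (forall x, 0 <= f x) ->
  \int[mu]_x f x = `|a|%:E * \int[mu]_x f (a * x + b)%R.
Proof.
move=> a0 mf f0; pose k : {nonneg R} := NngNum (normr_ge0 a).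
have mphi := measurable_affine a b.
have := ge0_integral_pushforward mphi mu measurableT mf (in1W f0).
rewrite preimage_setT => <-.
apply: etrans (ge0_integral_mscale _ measurableT k mf _) => //.
by apply: eq_measure_integral => A mA _; exact: lebesgue_measure_affine.
Qed.

Lemma normal_pdf_scale c x : c != 0%R ->
  (`|c| * normal_pdf 0 `|c| (c * x) = normal_pdf 0 1 x)%R.
Proof.
move=> c0; rewrite !normal_pdfE ?oner_eq0 ?normr_eq0//.
rewrite /normal_peak /normal_fun !subr0 real_normK ?num_real//.
rewrite expr1n mul1r -mulrnAr sqrtrM ?sqr_ge0// sqrtr_sqr invfM.
rewrite !mulrA divff ?normr_eq0// mul1r; congr (_ * expR _)%R.
by field.
Qed.

Lemma normal_prob_scale c (A : set R) : c != 0%R -> measurable A ->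
  normal_prob 0 1 ((fun x => c * x)%R @^-1` A) = normal_prob 0 `|c| A.
Proof.
move=> c0 mA; rewrite /normal_prob [RHS]integral_mkcond.
rewrite (@ge0_integral_affine c 0)//; last 2 first.
- apply/(measurable_restrictT _ mA)/measurable_EFinP/measurable_funTS.
  exact: measurable_normal_pdf.
- by move=> x; apply: erestrict_ge0 => {}x; rewrite lee_fin normal_pdf_ge0.
rewrite -ge0_integralZl//; first last.
- by move=> x _; apply: erestrict_ge0 => {}x; rewrite lee_fin normal_pdf_ge0.
- apply: (measurableT_comp (f := (fun x => (normal_pdf 0 `|c| x)%:E) \_ A));
    last exact: measurable_affine.
  apply/(measurable_restrictT _ mA)/measurable_EFinP/measurable_funTS.
  exact: measurable_normal_pdf.
rewrite [LHS]integral_mkcond; apply: eq_integral => x _.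
rewrite !patchE addr0 -(normal_pdf_scale x c0).
rewrite (_ : (x \in _ @^-1` A) = ((c * x)%R \in A)); last first.
  by apply/idP/idP; rewrite !inE.
by case: ifP => _; rewrite ?mule0.
Qed.

(* Completing the square in [x]. *)
Lemma normal_pdf_mul s t (r : R) x (u : R) : (0 < s)%R -> (0 < t)%R -> (0 < r)%R ->
  (r ^+ 2 = s ^+ 2 + t ^+ 2)%R ->
  (normal_pdf 0 t (u - x) * normal_pdf 0 s x =
   normal_pdf 0 r u * normal_pdf (u * (s / r) ^+ 2) (s * t / r) x)%R.
Proof.
move=> s0 t0 r0 rE.
have str : (0 < s * t / r)%R by rewrite divr_gt0// mulr_gt0.
rewrite !normal_pdfE ?gt_eqF// /normal_peak /normal_fun !subr0.
rewrite mulrACA [RHS]mulrACA -!invfM -!sqrtrM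
  ?mulrn_wge0 ?mulr_ge0 ?sqr_ge0 ?pi_ge0 ?ltW//.
rewrite -!expRD; congr (_^-1 * expR _)%R.
  by congr (Num.sqrt _); field; rewrite gt_eqF.
have r2 : (s ^+ 2 + t ^+ 2 != 0)%R by rewrite -rE gt_eqF// exprn_gt0.
rewrite !expr_div_n rE exprMn; field.
by rewrite r2 !gt_eqF.
Qed.

(** Substitute u = x + y and integrate over x first: by [normal_pdf_mul] the integrand is the target
    density at u times a normal density in x, whose integral is 1. *)
Lemma normal_prob_conv s t (r : R) (A : set R) : (0 < s)%R -> (0 < t)%R -> (0 < r)%R ->
  (r ^+ 2 = s ^+ 2 + t ^+ 2)%R -> measurable A ->
  \int[normal_prob 0 s]_x normal_prob 0 t ((fun y => x + y)%R @^-1` A) =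
  normal_prob 0 r A.
Proof.
move=> s0 t0 r0 rE mA.
have mpdf m s' : measurable_fun [set: measurableTypeR R] (fun x : R => (normal_pdf m s' x)%:E).
  by apply/measurable_EFinP; exact: measurable_normal_pdf.
pose F (z : R * R) :=
  ((\1_A z.2 * normal_pdf 0 t (z.2 - z.1) * normal_pdf 0 s z.1)%:E : \bar R).
have mF : measurable_fun setT F.
  apply/measurable_EFinP; apply: measurable_funM; last first.
    exact: measurableT_comp (measurable_normal_pdf 0 s) measurable_fst.
  apply: measurable_funM; first exact: measurableT_comp measurable_snd.
  apply: (measurableT_comp (measurable_normal_pdf 0 t)).
  by apply: measurable_funB; [exact: measurable_snd|exact: measurable_fst].
have F0 z : 0 <= F z by rewrite lee_fin !mulr_ge0// normal_pdf_ge0.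
have E x : normal_prob 0 t ((fun y => x + y)%R @^-1` A) * (normal_pdf 0 s x)%:E
    = \int[mu]_u F (x, u).
  rewrite /normal_prob integral_mkcond -ge0_integralZr//; first last.
  - by rewrite lee_fin normal_pdf_ge0.
  - by move=> y _; apply: erestrict_ge0 => {}y; rewrite lee_fin normal_pdf_ge0.
  - have mxA : measurable ((fun y => x + y)%R @^-1` A).
      rewrite -[X in measurable X]setTI.
      by apply: measurable_funD => //; exact: measurable_cst.
    apply/(measurable_restrictT _ mxA)/measurable_EFinP/measurable_funTS.
    exact: measurable_normal_pdf.
  rewrite [RHS](@ge0_integral_affine 1 x)//; first last.
    exact: (measurableT_comp mF (pair1_measurable x)).
  rewrite normr1 mul1e; apply: eq_integral => y _.
  rewrite patchE /F/= mul1r addrK indicE addrC.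
  rewrite (_ : (y \in _ @^-1` A) = ((x + y)%R \in A)); last first.
    by apply/idP/idP; rewrite !inE.
  by case: (_ \in A); rewrite ?mul1r// !mul0r mul0e.
rewrite ge0_integral_normal_prob//; last first.
  have -> : (fun x => normal_prob 0 t ((fun y => x + y)%R @^-1` A)) =
     normal_prob 0 t \o xsection ((fun z : R * R => z.1 + z.2)%R @^-1` A).
    apply/funext => x /=; congr normal_prob; apply/seteqP.
    by split => y; rewrite /xsection/= inE.
  apply: measurable_fun_xsection.
  rewrite -[X in measurable X]setTI.
  exact: measurable_funD.
under eq_integral do rewrite E.
rewrite (@fubini_tonelli _ _ _ _ _ mu mu _ mF F0) /normal_prob [RHS]integral_mkcond.
apply: eq_integral => u _; rewrite patchE.
under eq_integral.
  move=> x _; rewrite /F/= -mulrA (normal_pdf_mul x u s0 t0 r0 rE); over.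
rewrite indicE; case: (u \in A).
  under eq_integral do rewrite mul1r EFinM.
  rewrite ge0_integralZl//; last 2 first.
  - by move=> x _; rewrite lee_fin normal_pdf_ge0.
  - by rewrite lee_fin normal_pdf_ge0.
  by rewrite integral_normal_pdf mule1.
by rewrite integral0_eq// => x _; rewrite mul0r.
Qed.

(** [gaussian_law 0 s] is only a set function; as a bundled probability it can be integrated against
    and enter product measures. *)
Definition centered_gaussian s : probability (measurableTypeR R) R :=
  if s == 0%R then (\d_(0%R : measurableTypeR R) : probability _ _)
  else (normal_prob 0 s : probability _ _).

Lemma centered_gaussianE s (A : set R) :
  centered_gaussian s A = gaussian_law 0 s A.
Proof. by rewrite /centered_gaussian /gaussian_law; case: ifP. Qed.

Lemma centered_gaussian_scale c (A : set R) : measurable A ->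
  normal_prob 0 1 ((fun x => c * x)%R @^-1` A) = centered_gaussian `|c| A.
Proof.
move=> mA; rewrite /centered_gaussian normr_eq0.
have [->|c0] := eqVneq c 0%R; last exact: normal_prob_scale.
rewrite /= diracE.
have [A0|A0] := boolP (0%R \in A).
  rewrite (_ : _ @^-1` A = setT) ?probability_setT//.
  by apply/seteqP; split => // x _ /=; rewrite mul0r; rewrite inE in A0.
rewrite (_ : _ @^-1` A = set0) ?measure0//.
by apply/seteqP; split => // x /=; rewrite mul0r; rewrite notin_setE in A0.
Qed.

Lemma centered_gaussian_conv s t (A : set R) : (0 <= s)%R -> (0 <= t)%R ->
    measurable A ->
  \int[centered_gaussian s]_x centered_gaussian t ((fun y => x + y)%R @^-1` A) =
  centered_gaussian (Num.sqrt (s ^+ 2 + t ^+ 2)) A.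
Proof.
rewrite 2!le_eqVlt => /predU1P[<- t0 mA|s0 /predU1P[<- mA|t0 mA]].
- rewrite expr0n/= add0r sqrtr_sqr ger0_norm; last by case/orP: t0 => [/eqP<-|/ltW].
  rewrite {1}/centered_gaussian eqxx integral_dirac//=.
  + rewrite diracT mul1e; congr (centered_gaussian _ _).
    by apply/seteqP; split => x /=; rewrite add0r.
  + have -> : (fun x => centered_gaussian t ((fun y => x + y)%R @^-1` A)) =
        centered_gaussian t \o xsection ((fun z : R * R => z.1 + z.2)%R @^-1` A).
      apply/funext => x /=; congr (centered_gaussian _ _); apply/seteqP.
      by split => y; rewrite /xsection/= inE.
    apply: measurable_fun_xsection.
    rewrite -[X in measurable X]setTI.
    exact: measurable_funD.
- rewrite expr0n/= addr0 sqrtr_sqr gtr0_norm// {2}/centered_gaussian eqxx.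
  transitivity (\int[centered_gaussian s]_x (\1_A x)%:E).
    apply: eq_integral => x _; rewrite /= diracE indicE; congr ((nat_of_bool _)%:R)%:E.
    by apply/idP/idP; rewrite !inE/= addr0.
  by rewrite integral_indic// setIT.
- rewrite /centered_gaussian !gt_eqF ?sqrtr_gt0 ?addr_gt0 ?exprn_gt0//.
  apply: normal_prob_conv; rewrite ?sqrtr_gt0 ?addr_gt0 ?exprn_gt0//.
  by rewrite sqr_sqrtr// addr_ge0// sqr_ge0.
Qed.

Local Close Scope ereal_scope.

Lemma is_derive_normal_pdf01 x :
  is_derive x (1 : R) (normal_pdf 0 1) (- (x * normal_pdf 0 1 x)).
Proof.
rewrite normal_pdfE ?oner_eq0// /normal_fun expr1n.
apply: (@is_derive_eq _ _ _ (fun x : R => normal_peak 1 * expR (- (x - 0) ^+ 2 / 2))).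
by rewrite /GRing.scale/= !subr0; field.
Qed.

Lemma cvg_mul_normal_pdf01 : (n%:R * normal_pdf 0 1 n%:R : R) @[n --> \oo] --> 0.
Proof.
apply: (@squeeze_cvgr _ _ _ _ (cst 0) (fun n => 2 * normal_peak 1 / n%:R)).
- near=> n; rewrite mulr_ge0 ?normal_pdf_ge0//=.
  have n0 : 0 < n%:R :> R by rewrite ltr0n; near: n; exists 1%N.
  rewrite ler_pdivlMr// normal_pdfE ?oner_eq0// /normal_fun subr0 expr1n mulNr expRN.
  set E := expR _; have E0 : 0 < E by exact: expR_gt0.
  (* From exp y >= 1 + y at y = n^2 / 2; it bounds the n-th term by a constant times 1 / n. *)
  have nE : n%:R ^+ 2 <= 2 * E.
    have := expR_ge1Dx (n%:R ^+ 2 / 2 : R); rewrite -/E; lra.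
  rewrite (_ : n%:R * _ * _ = n%:R ^+ 2 / E * normal_peak 1); last by ring.
  by rewrite ler_wpM2r ?normal_peak_ge0// ler_pdivrMr.
- exact: cvg_cst.
- rewrite -[X in _ --> X](mulr0 (2 * normal_peak 1)).
  apply: cvgM; first exact: cvg_cst.
  by rewrite -cvg_shiftS; exact: cvg_harmonic.
Unshelve. all: by end_near. Qed.

Local Open Scope ereal_scope.

(** The derivative of minus the density is x times the density, so integrating x * (x * pdf) by
    parts over [-n, n] leaves a vanishing boundary term and the total mass. *)
Lemma normal_prob_second_moment :
  \int[normal_prob 0 1]_x ((x : R) ^+ 2)%:E = 1.
Proof.
have cp : continuous (normal_pdf 0 1 : R -> R).
  by apply: continuous_normal_pdf; exact: oner_neq0.
have mp := measurable_normal_pdf (0 : R) 1.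
rewrite ge0_integral_normal_prob//; last first.
- by move=> x; rewrite lee_fin sqr_ge0.
- by apply/measurable_EFinP; exact: measurable_funX.
pose F n := (`[- n%:R, n%:R]%classic : set R)%R.
have ndF : nondecreasing_seq F.
  move=> m n mn; apply/subsetPset/subset_itv; rewrite bnd_simp ?lerN2 ler_nat//.
have UF : \bigcup_n F n = setT.
  apply/seteqP; split => // x _; exists (Num.truncn `|x|).+1 => //=.
  by rewrite /F/= in_itv/= -ler_norml ltW// truncnS_gt.
have cvgF (h : R -> R) : measurable_fun setT h -> (forall x, 0 <= h x)%R ->
    \int[mu]_(x in F n) (h x)%:E @[n --> \oo] --> \int[mu]_x (h x)%:E.
  move=> mh h0; rewrite -[in X in _ --> X]UF.
  apply: ge0_nondecreasing_set_cvg_integral => //.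
  - by move=> n; exact: measurable_itv.
  - by move=> n; apply/measurable_EFinP; exact: measurable_funTS.
  - by move=> n x _; rewrite lee_fin.
(* The shift to [n.+1] makes the interval nondegenerate, as integration by parts requires. *)
have partsF n : \int[mu]_(x in F n.+1) (x ^+ 2 * normal_pdf 0 1 x)%:E =
    (- (2 * (n.+1%:R * normal_pdf 0 1 n.+1%:R)))%:E +
    \int[mu]_(x in F n.+1) (normal_pdf 0 1 x)%:E.
  pose p x := (- normal_pdf 0 1 x : R)%R.
  transitivity (\int[mu]_(x in F n.+1) (x * (x * normal_pdf 0 1 x))%:E).
    by apply: eq_integral => x _; rewrite expr2 mulrA.
  have dp (x : R) : is_derive x (1%R : R) p (x * normal_pdf 0 1 x)%R.
    by have := is_deriveN (is_derive_normal_pdf01 x); rewrite opprK.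
  have cpp : continuous p by move=> x; apply: cvgN; exact: cp.
  have cxp : continuous (fun x => x * normal_pdf 0 1 x : R)%R.
    by move=> x; apply: cvgM; [exact: cvg_id|exact: cp].
  have ab : (- n.+1%:R < n.+1%:R :> R)%R by rewrite gtrN.
  rewrite /F (@integration_by_parts _ id p (cst 1%R)
      (fun x => x * normal_pdf 0 1 x)%R _ _ ab).
  - rewrite /p; congr (_%:E + _); last first.
      transitivity (- \int[mu]_(x in F n.+1) - (normal_pdf 0 1 x)%:E).
        by congr (- _); apply: eq_integral => x _; rewrite mul1r.
      by rewrite integral_ge0N ?oppeK// => x _; rewrite lee_fin normal_pdf_ge0.
    rewrite (_ : normal_pdf 0 1 (- n.+1%:R) = normal_pdf 0 1 n.+1%:R)%R; last first.
      by rewrite normal_pdfE ?oner_eq0// /normal_fun !subr0 sqrrN.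
    by rewrite !mulNr !mulrN opprK -mulr2n mulr_natl mulNrn.
  - by apply: continuous_subspaceT => x; exact: cvg_cst.
  - split => [x _||].
    + exact: derivable_id.
    + exact: (@cvg_at_right_filter _ _ id).
    + exact: (@cvg_at_left_filter _ _ id).
  - by move=> x _; rewrite derive1E derive_id.
  - exact: continuous_subspaceT.
  - split => [x _||].
    + by have [] := dp x.
    + exact: cvg_at_right_filter (cpp _).
    + exact: cvg_at_left_filter (cpp _).
  - by move=> x _; rewrite derive1E; have [_ ->] := dp x.
have L1 := cvgF (fun x => x ^+ 2 * normal_pdf 0 1 x)%R.
have L2 := cvgF (normal_pdf 0 1) mp (normal_pdf_ge0 0 1).
have {}L1 : \int[mu]_(x in F n) (x ^+ 2 * normal_pdf 0 1 x)%:E @[n --> \oo] -->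
    \int[mu]_x (x ^+ 2 * normal_pdf 0 1 x)%:E.
  apply: L1 => [|x].
    by apply: measurable_funM => //; exact: measurable_funX.
  by rewrite mulr_ge0 ?sqr_ge0 ?normal_pdf_ge0.
rewrite integral_normal_pdf in L2.
under eq_integral do rewrite -EFinM.
suff L3 : \int[mu]_(x in F n) (x ^+ 2 * normal_pdf 0 1 x)%:E @[n --> \oo] --> 1.
  exact: (cvg_unique (@ereal_hausdorff R) L1 L3).
pose a n := (- (2 * (n.+1%:R * normal_pdf 0 1 n.+1%:R)))%:E : \bar R.
pose b n := \int[mu]_(x in F n.+1) (normal_pdf 0 1 x)%:E.
have La : a n @[n --> \oo] --> 0.
  apply: cvg_EFin; first exact: nearW.
  have := cvgN (cvgM (@cvg_cst _ (2%R : R) _ _ _) cvg_mul_normal_pdf01).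
  by rewrite mulr0 oppr0 -cvg_shiftS; exact.
have Lb : b n @[n --> \oo] --> 1 by move: L2; rewrite -(cvg_shiftS _ _).
have L4 : (a \+ b) @ \oo --> 0 + 1 by exact: cvgeD La Lb.
rewrite add0e in L4.
rewrite -(cvg_shiftS _ _).
suff -> : [sequence \int[mu]_(x in F n.+1) (x ^+ 2 * normal_pdf 0 1 x)%:E]_n =
    a \+ b by [].
by apply/funext => n; exact: partsF.
Qed.

End normal.

(** * Frobenius product, Cholesky factorization, Rayleigh quotients *)

Section linear_algebra.
Context {R : realType}.

Definition frob p q (A B : 'M[R]_(p, q)) : R := \tr (A *m B^T).

Lemma frobE p q (A B : 'M[R]_(p, q)) : frob A B = \sum_i \sum_j A i j * B i j.
Proof.
by apply: eq_bigr => i _; rewrite mxE; apply: eq_bigr => j _; rewrite mxE.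
Qed.

Lemma frobC p q (A B : 'M[R]_(p, q)) : frob A B = frob B A.
Proof.
by rewrite !frobE; apply: eq_bigr => i _; apply: eq_bigr => j _; rewrite mulrC.
Qed.

Lemma frobDl p q (A B C : 'M[R]_(p, q)) : frob (A + B) C = frob A C + frob B C.
Proof. by rewrite /frob mulmxDl mxtraceD. Qed.

Lemma frobBl p q (A B C : 'M[R]_(p, q)) : frob (A - B) C = frob A C - frob B C.
Proof. by rewrite /frob mulmxBl raddfB. Qed.

Lemma frobZl p q (a : R) (A B : 'M[R]_(p, q)) : frob (a *: A) B = a * frob A B.
Proof. by rewrite /frob -scalemxAl mxtraceZ. Qed.

Lemma frob_suml p q I (r : seq I) (F : I -> 'M[R]_(p, q)) B :
  frob (\sum_(i <- r) F i) B = \sum_(i <- r) frob (F i) B.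
Proof. by rewrite /frob mulmx_suml raddf_sum. Qed.

Lemma frobBr p q (A B C : 'M[R]_(p, q)) : frob C (A - B) = frob C A - frob C B.
Proof. by rewrite !(frobC C) frobBl. Qed.

Lemma frobZr p q (a : R) (A B : 'M[R]_(p, q)) : frob B (a *: A) = a * frob B A.
Proof. by rewrite !(frobC B) frobZl. Qed.

Lemma frob_sumr p q I (r : seq I) (F : I -> 'M[R]_(p, q)) B :
  frob B (\sum_(i <- r) F i) = \sum_(i <- r) frob B (F i).
Proof. by rewrite frobC frob_suml; apply: eq_bigr => i _; rewrite frobC. Qed.

Lemma frob_ge0 p q (A : 'M[R]_(p, q)) : 0 <= frob A A.
Proof.
by rewrite frobE; apply: sumr_ge0 => i _; apply: sumr_ge0 => j _; rewrite -expr2 sqr_ge0.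
Qed.

Lemma frob_eq0 p q (A : 'M[R]_(p, q)) : frob A A = 0 -> A = 0.
Proof.
rewrite frobE => /eqP; rewrite psumr_eq0; last first.
  by move=> i _; apply: sumr_ge0 => j _; rewrite -expr2 sqr_ge0.
move=> /allP A0; apply/matrixP => i j; rewrite !mxE.
have := A0 i (mem_index_enum _); rewrite implyTb psumr_eq0; last first.
  by move=> k _; rewrite -expr2 sqr_ge0.
by move=> /allP/(_ j (mem_index_enum _))/=; rewrite mulf_eq0 orbb => /eqP.
Qed.

Lemma frob_col p q (A : 'M[R]_(p, q)) : frob A A = \sum_j frob (col j A) (col j A).
Proof.
rewrite frobE exchange_big/=; apply: eq_bigr => j _.
by rewrite frobE; apply: eq_bigr => i _; rewrite big_ord1 !mxE.
Qed.

Lemma frob_trmx p q (A : 'M[R]_(p, q)) : frob A^T A^T = frob A A.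
Proof.
rewrite !frobE exchange_big/=; apply: eq_bigr => i _.
by apply: eq_bigr => j _; rewrite !mxE.
Qed.

Lemma frob_mulmxl p q r (C : 'M[R]_(r, p)) (A : 'M[R]_(p, q)) B :
  frob (C *m A) B = frob A (C^T *m B).
Proof. by rewrite /frob trmx_mul trmxK -mulmxA mxtrace_mulC mulmxA. Qed.

Lemma frob_mulmxr p q r (A : 'M[R]_(p, q)) (C : 'M[R]_(q, r)) B :
  frob (A *m C) B = frob A (B *m C^T).
Proof. by rewrite /frob trmx_mul trmxK mulmxA. Qed.

Lemma frob_quad n (A : 'M[R]_n) (x : 'cV[R]_n) : quad_form A x = frob (A *m x) x.
Proof.
by rewrite /quad_form /frob mxtrace_mulC mulmxA /mxtrace big_ord1.
Qed.

Lemma quad_form_gram n q (S : 'M[R]_(n, q)) (x : 'cV[R]_n) :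
  quad_form (S *m S^T) x = frob (S^T *m x) (S^T *m x).
Proof. by rewrite frob_quad -mulmxA frob_mulmxl. Qed.

(** Induction on the dimension: the Schur complement of the corner entry [a] is again positive
    definite, and its factor [S'] completes a block triangular factor of [V]. *)
Lemma cholesky n (V : 'M[R]_n) : positive_definite V ->
  exists S : 'M[R]_n, S *m S^T = V.
Proof.
elim: n V => [|n IH] V [Vsym Vpos]; first by exists 0; apply/matrixP => -[].
move: V Vsym Vpos; rewrite -[n.+1]/(1 + n)%N => V Vsym Vpos.
pose b := dlsubmx V; pose C := drsubmx V; pose a := V 0 0.
have ulE : ulsubmx V = a%:M.
  apply/matrixP => i j; rewrite !ord1 !mxE eqxx mulr1n.
  by congr (V _ _); apply/val_inj.
have urE : ursubmx V = b^T by rewrite /b trmx_dlsub Vsym.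
have Csym : C^T = C by rewrite /C trmx_drsub Vsym.
have VE : V = block_mx a%:M b^T b C by rewrite -ulE -urE submxK.
have a_gt0 : 0 < a.
  have := Vpos (delta_mx 0 0); rewrite /quad_form trmx_delta -rowE.
  rewrite -colE !mxE; apply.
  by apply/eqP => /matrixP/(_ 0 0); rewrite !mxE !eqxx => /eqP; rewrite oner_eq0.
have [] := IH (C - a^-1 *: (b *m b^T)).
  split; first by rewrite /Defs.symmetric linearB/= Csym linearZ/= trmx_mul trmxK.
  move=> x x0.
  (* For fixed [x] this first block minimizes the form of [V]; the minimum is the form of the Schur
     complement at [x]. *)
  have xx0 : col_mx (- (a^-1 *: (b^T *m x))) x != 0 :> 'cV_(1 + n).
    apply: contra x0; rewrite -[X in _ == X]vsubmxK => /eqP/eq_col_mx[_ ->].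
    by rewrite linear0.
  have := Vpos _ xx0; congr (0 < _).
  rewrite /quad_form {1}VE tr_col_mx mul_row_block mul_row_col.
  have -> : (- (a^-1 *: (b^T *m x)))^T = - (a^-1 *: (x^T *m b)).
    by rewrite linearN/= linearZ/= trmx_mul trmxK.
  rewrite mul_mx_scalar scalerN scalerA divff ?gt_eqF// scale1r addNr mul0mx add0r.
  congr (fun_of_matrix (_ *m x) 0 0).
  by rewrite mulmxBr mulNmx -scalemxAr mulmxA -scalemxAl addrC.
move=> S' S'E; pose ra := Num.sqrt a.
have ra_gt0 : 0 < ra by rewrite sqrtr_gt0.
have ra2 : ra * ra = a by rewrite -expr2 sqr_sqrtr ?ltW.
exists (block_mx ra%:M 0 (ra^-1 *: b) S').
rewrite VE tr_block_mx mulmx_block tr_scalar_mx !trmx0 !mulmx0 mul0mx !addr0.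
congr block_mx.
- by rewrite -scalar_mxM ra2.
- by rewrite mul_scalar_mx linearZ/= scalerA divff ?gt_eqF// scale1r.
- by rewrite mul_mx_scalar scalerA divff ?gt_eqF// scale1r.
- rewrite S'E linearZ/= -scalemxAl -scalemxAr scalerA -invfM ra2.
  by rewrite addrC subrK.
Qed.

(** With y = Q c, the form at c + t y is t (2 a + t b); a small negative t would make it negative if
    a = |y|^2 were positive. *)
Lemma psd_null n (Q : 'M[R]_n) (c : 'cV[R]_n) : positive_semidefinite Q ->
  quad_form Q c = 0 -> Q *m c = 0.
Proof.
move=> [Qsym Qpos] Qc; apply: frob_eq0.
pose y := Q *m c; set a := frob _ _; pose b := frob (Q *m y) y.
have a0 : 0 <= a by exact: frob_ge0.
have b0 : 0 <= b by rewrite /b -frob_quad.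
have key t : 0 <= t * (2 * a + t * b).
  have := Qpos (c + t *: y); rewrite frob_quad mulmxDr -scalemxAr.
  rewrite frobDl !(frobC _ (c + _)) !frobDl !frobZl !frobZr.
  rewrite (frobC c (Q *m c)) -frob_quad Qc add0r -[frob y (Q *m c)]/a.
  rewrite (_ : frob c (Q *m y) = a); last by rewrite frobC frob_mulmxl Qsym.
  rewrite frobC -/b => /le_trans; apply; rewrite le_eqVlt; apply/orP; left.
  by apply/eqP; ring.
apply/eqP; rewrite eq_le a0 andbT leNgt; apply/negP => a_gt0.
have b1 : 0 < b + 1 by rewrite ltr_wpDl.
(* The minimizer -a / b is avoided because [b] may be 0. *)
have := key (- (a / (b + 1))); rewrite mulNr oppr_ge0 leNgt => /negP; apply.
rewrite mulr_gt0 ?divr_gt0// mulNr subr_gt0 mulrAC ltr_pdivrMr//.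
have := mulr_ge0 a0 b0; lra.
Qed.

(** Maximize the form on the unit sphere, which is compact. The maximum l makes [l%:M - W]
    semidefinite with a null form at the maximizer [c], so [psd_null] makes [c] an eigenvector
    without any differentiation. *)
Lemma rayleigh_max n (W : 'M[R]_n.+1) : W^T = W ->
  exists2 l, eigenvalue W l & forall x : 'cV_n.+1, quad_form W x <= l * frob x x.
Proof.
move=> Wsym.
pose f (u : 'rV[R]_n.+1) : R := \sum_i \sum_j (W i j * u 0 j) * u 0 i.
pose g (u : 'rV[R]_n.+1) : R := \sum_i u 0 i * u 0 i.
have cc (i : 'I_n.+1) : continuous (fun u : 'rV[R]_n.+1 => u 0 i : R).
  exact: coord_continuous.
have addc : continuous (fun z : R * R => z.1 + z.2) by exact: add_continuous.
have cf : continuous f.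
  rewrite /f; apply: (continuous_big addc) => i _.
  apply: (continuous_big addc) => j _ u.
  apply: (@continuousM _ _ (fun v : 'rV[R]_n.+1 => W i j * v 0 j) (fun v => v 0 i));
    last exact: cc.
  apply: (@continuousM _ _ (fun=> W i j) (fun v : 'rV[R]_n.+1 => v 0 j));
    [exact: cst_continuous|exact: cc].
have cg : continuous g.
  apply: (continuous_big addc) => i _ u.
  by apply: (@continuousM _ _ (fun v : 'rV[R]_n.+1 => v 0 i) (fun v => v 0 i));
    exact: cc.
have fE u : f u = quad_form W u^T.
  rewrite frob_quad frobE; apply: eq_bigr => i _; rewrite big_ord1 !mxE mulr_suml.
  by apply: eq_bigr => j _; rewrite !mxE.
have gE u : g u = frob u^T u^T.
  by rewrite frobE; apply: eq_bigr => i _; rewrite big_ord1 !mxE.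
pose A := [set u | g u = 1].
have [|||c] := @EVT_max_rV R n.+1 f A.
- exists (delta_mx 0 0); rewrite /A/= /g (bigD1 ord0)//= !mxE !eqxx mulr1 big1 ?addr0//.
  by move=> i i0; rewrite mxE (negbTE i0) andbF mulr0.
- apply: bounded_closed_compact.
    exists 1; split; first exact: num_real.
    move=> M M1 u; rewrite /A/= => gu; rewrite [leLHS]/Num.norm/= mx_normrE.
    apply: bigmax_le => [|[i j] _ /=]; first by rewrite ltW// (lt_trans ltr01).
    apply: le_trans (ltW M1); rewrite ord1 -(@ler_pXn2r _ 2)// ?nnegrE// expr1n.
    rewrite real_normK ?num_real// -gu /g (bigD1 j)//= expr2 lerDl.
    by apply: sumr_ge0 => k _; rewrite -expr2 sqr_ge0.
  rewrite (_ : A = g @^-1` [set 1]); last by [].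
  by apply: (closed_comp (fun x _ => cg x)); exact: closed_eq.
- exact: continuous_subspaceT.
rewrite inE => cA cmax; pose l := f c.
have lP (x : 'cV_n.+1) : quad_form W x <= l * frob x x.
  have [->|x0] := eqVneq x 0.
    by rewrite frob_quad /frob trmx0 !mulmx0 mxtrace0 mulr0.
  have xx0 : 0 < frob x x.
    rewrite lt_neqAle frob_ge0 andbT eq_sym; apply: contra x0 => /eqP.
    by move/frob_eq0 ->.
  pose s := Num.sqrt (frob x x); have s0 : 0 < s by rewrite sqrtr_gt0.
  have s2 : s * s = frob x x by rewrite -expr2 sqr_sqrtr ?frob_ge0.
  have /cmax : s^-1 *: x^T \in A.
    rewrite inE /A/= gE linearZ/= trmxK frobZl frobZr -s2; field.
    by rewrite gt_eqF.
  rewrite fE linearZ/= trmxK frob_quad -scalemxAr frobZl frobZr -frob_quad.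
  rewrite mulrA -invfM s2 mulrC ler_pdivrMr//.
exists l => //.
have lQ : positive_semidefinite (l%:M - W).
  split; first by rewrite /Defs.symmetric linearB/= tr_scalar_mx Wsym.
  move=> x; rewrite frob_quad mulmxBl mul_scalar_mx frobBl frobZl subr_ge0.
  by rewrite -frob_quad.
have : quad_form (l%:M - W) c^T = 0.
  rewrite frob_quad mulmxBl mul_scalar_mx frobBl frobZl -gE cA mulr1.
  by rewrite -frob_quad -fE subrr.
move/(psd_null lQ); rewrite mulmxBl mul_scalar_mx => /eqP; rewrite subr_eq0 => /eqP Wc.
apply/eigenvalueP; exists c.
  by apply: trmx_inj; rewrite trmx_mul Wsym linearZ.
apply/eqP => c0; move: cA; rewrite /A/= gE c0 trmx0 /frob mul0mx mxtrace0 => /eqP.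
by rewrite eq_sym oner_eq0.
Qed.

Lemma rayleigh_le n (W : 'M[R]_n) l (x : 'cV_n) : W^T = W ->
  largest_eigenvalue W l -> quad_form W x <= l * frob x x.
Proof.
case: n W x => [|n] W x Wsym [_ lmax].
  by rewrite frob_quad /frob !(flatmx0 (_ *m _)) !mxtrace0 mulr0.
have [a /lmax al ax] := rayleigh_max Wsym.
by apply: le_trans (ax x) _; rewrite ler_wpM2r ?frob_ge0.
Qed.

Lemma rayleigh_ge n (W : 'M[R]_n) l (x : 'cV_n) : W^T = W ->
  smallest_eigenvalue W l -> l * frob x x <= quad_form W x.
Proof.
case: n W x => [|n] W x Wsym [_ lmin].
  by rewrite frob_quad /frob !(flatmx0 (_ *m _)) !mxtrace0 mulr0.
have [|a /eigenvalueP[v vW v0] ax] := @rayleigh_max n (- W).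
  by rewrite linearN/= Wsym.
have /lmin la : eigenvalue W (- a).
  by apply/eigenvalueP; exists v => //; rewrite scaleNr -vW mulmxN opprK.
have := ax x; rewrite frob_quad mulNmx -scaleN1r frobZl mulN1r -frob_quad lerNl => h.
by apply: le_trans h; rewrite -mulNr ler_wpM2r ?frob_ge0.
Qed.

Lemma positive_definite_gram_unit n (S : 'M[R]_n) :
  positive_definite (S *m S^T) -> S \in unitmx.
Proof.
move=> [_ Spos]; rewrite -row_free_unit; apply: inj_row_free => v vS.
apply/eqP; apply: contraT => v0.
have : v^T != 0 by apply: contra v0 => /eqP vT; rewrite -[v]trmxK vT trmx0.
by move/Spos; rewrite quad_form_gram -trmx_mul vS trmx0 /frob mul0mx mxtrace0 ltxx.
Qed.

Lemma eigenvalue_gram n (S : 'M[R]_n) a : S \in unitmx ->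
  eigenvalue (S^T *m S) a -> eigenvalue (S *m S^T) a.
Proof.
move=> Su /eigenvalueP[v vS v0]; apply/eigenvalueP; exists (v *m S^T).
  by rewrite mulmxA -(mulmxA v) vS scalemxAl.
apply: contra v0 => /eqP vS0; apply/eqP.
by rewrite -[v](@mulmxK _ _ _ S^T) ?unitmx_tr// vS0 mul0mx.
Qed.

(** The spectrum is given for V = S S^T, but in the coordinates Y the Rayleigh quotients are those
    of S^T S. *)
Lemma eigenvalue_gramC n (S : 'M[R]_n) : S \in unitmx ->
  eigenvalue (S^T *m S) =1 eigenvalue (S *m S^T).
Proof.
move=> Su a; apply/idP/idP; first exact: eigenvalue_gram.
by have := @eigenvalue_gram n S^T a; rewrite trmxK unitmx_tr; apply.
Qed.

End linear_algebra.

(** * Averages over words of random projections *)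

Section random_projections.
Context {R : realType} (n N : nat) (S : 'M[R]_n).
Hypothesis n_gt0 : (0 < n)%N.
Hypothesis S_row : forall j, (S *m S^T) j j = 1.
Implicit Types (s : seq 'I_n) (j : 'I_n) (A B : 'M[R]_n).

Let nR : n%:R != 0 :> R. Proof. by rewrite pnatr_eq0 -lt0n. Qed.

Fixpoint words k : seq (seq 'I_n) :=
  if k is k'.+1 then [seq j :: s | j <- enum 'I_n, s <- words k'] else [:: [::]].

Lemma size_words k s : s \in words k -> size s = k.
Proof.
elim: k s => [|k IH] s /=; first by rewrite inE => /eqP->.
by move=> /allpairsP[[j t] [_ /IH tk ->]] /=; rewrite tk.
Qed.

Lemma big_words T (idx : T) (op : Monoid.com_law idx) k (F : seq 'I_n -> T) :
  \big[op/idx]_(s <- words k.+1) F s =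
  \big[op/idx]_j \big[op/idx]_(s <- words k) F (j :: s).
Proof. by rewrite /= big_allpairs_dep big_enum. Qed.

Lemma length_words k : size (words k) = (n ^ k)%N.
Proof. by elim: k => //= k IH; rewrite size_allpairs IH size_enum_ord expnS. Qed.

(** Expectation over [k] independent uniform draws. It is taken in any module because both matrices
    and scalars (as [R^o]) are averaged. *)
Definition mean (M : lmodType R) k (F : seq 'I_n -> M) : M :=
  (n%:R^-1) ^+ k *: \sum_(s <- words k) F s.

Lemma eq_mean (M : lmodType R) k (F G : seq 'I_n -> M) :
  (forall s, size s = k -> F s = G s) -> mean k F = mean k G.
Proof.
move=> FG; congr (_ *: _); rewrite big_seq [RHS]big_seq.
by apply: eq_bigr => s /size_words/FG.
Qed.

Lemma mean0 (M : lmodType R) (F : seq 'I_n -> M) : mean 0 F = F [::].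
Proof. by rewrite /mean expr0 scale1r big_seq1. Qed.

Lemma mean_cons (M : lmodType R) k (F : seq 'I_n -> M) :
  mean k.+1 F = n%:R^-1 *: \sum_j mean k (fun s => F (j :: s)).
Proof.
rewrite /mean big_words exprS -scalerA; congr (_ *: _).
by rewrite scaler_sumr.
Qed.

Lemma meanD (M : lmodType R) k (F G : seq 'I_n -> M) :
  mean k (fun s => F s + G s) = mean k F + mean k G.
Proof. by rewrite /mean big_split scalerDr. Qed.

Lemma mean_cst (M : lmodType R) k (c : M) : mean k (fun=> c) = c.
Proof.
rewrite /mean big_const_seq count_predT length_words iter_addr_0.
rewrite -(scaler_nat (n ^ k) c) scalerA.
by rewrite natrX -exprMn mulVf// expr1n scale1r.
Qed.

Lemma ler_mean k (F G : seq 'I_n -> R^o) :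
  (forall s, size s = k -> F s <= G s) -> mean k F <= mean k G :> R.
Proof.
move=> FG; rewrite /mean /GRing.scale/= ler_wpM2l ?exprn_ge0 ?invr_ge0//.
rewrite big_seq [leRHS]big_seq; apply: ler_sum => s /size_words; exact: FG.
Qed.

(* Locked so that matrix rewriting lemmas do not see through these products. *)
Definition dir j : 'cV[R]_n := locked (S^T *m delta_mx j 0).
Definition proj j : 'M[R]_n := locked (1%:M - dir j *m (dir j)^T).

Lemma projE j : proj j = 1%:M - dir j *m (dir j)^T.
Proof. by rewrite /proj -lock. Qed.

Lemma dirE j a : dir j a 0 = S j a.
Proof. by rewrite /dir -lock -colE !mxE. Qed.

Lemma dir_norm j : (dir j)^T *m dir j = 1%:M.
Proof.
apply/matrixP => a b; rewrite !ord1 !mxE eqxx mulr1n -(S_row j) mxE.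
by apply: eq_bigr => k _; rewrite !mxE !dirE.
Qed.

Lemma proj_tr j : (proj j)^T = proj j.
Proof. by rewrite projE linearB/= trmx1 trmx_mul trmxK. Qed.

Lemma proj_dir j : proj j *m dir j = 0.
Proof. by rewrite projE mulmxBl mul1mx -mulmxA dir_norm mulmx1 subrr. Qed.

Lemma projK j : proj j *m proj j = proj j.
Proof. by rewrite {2}projE mulmxBr mulmx1 mulmxA proj_dir mul0mx subr0. Qed.

Lemma sum_dir : \sum_j dir j *m (dir j)^T = S^T *m S.
Proof.
apply/matrixP => a b; rewrite summxE mxE; apply: eq_bigr => j _.
by rewrite !mxE big_ord1 dirE mxE dirE.
Qed.

(** The operator Phi of the overview. *)
Definition avg A : 'M[R]_n := n%:R^-1 *: \sum_j proj j *m A *m proj j.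

Lemma avgB A B : avg (A - B) = avg A - avg B.
Proof.
rewrite /avg -scalerBr -sumrB; congr (_ *: _); apply: eq_bigr => j _.
by rewrite (mulmxBr (proj j) A B) mulmxBl.
Qed.

Lemma avgD A B : avg (A + B) = avg A + avg B.
Proof.
rewrite /avg -scalerDr -big_split; congr (_ *: _); apply: eq_bigr => j _.
by rewrite (mulmxDr (proj j) A B) mulmxDl.
Qed.

Lemma avg0 : avg 0 = 0.
Proof. by rewrite -{1}(subrr 0) avgB subrr. Qed.

Lemma avg_sum I (r : seq I) (F : I -> 'M[R]_n) :
  avg (\sum_(i <- r) F i) = \sum_(i <- r) avg (F i).
Proof. exact: (big_morph _ avgD avg0). Qed.

Lemma frob_avgC A B : frob (avg A) B = frob A (avg B).
Proof.
rewrite /avg frobZl frobZr frob_suml frob_sumr; congr (_ * _).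
by apply: eq_bigr => j _; rewrite frob_mulmxr frob_mulmxl proj_tr mulmxA.
Qed.

(** The map A |-> P_j A P_j is self-adjoint and idempotent for [frob]. *)
Lemma frob_proj j A : frob A (proj j *m A *m proj j) =
  frob (proj j *m A *m proj j) (proj j *m A *m proj j).
Proof.
rewrite [RHS]frob_mulmxr proj_tr -(mulmxA _ (proj j) (proj j)) projK.
by rewrite frob_mulmxl proj_tr !mulmxA projK.
Qed.

Lemma frob_avg_le A : frob A (avg A) <= frob A A.
Proof.
rewrite /avg frobZr frob_sumr ler_pdivrMl ?ltr0n// mulr_natl.
rewrite -[X in _ *+ X]card_ord -sumr_const; apply: ler_sum => j _.
have := frob_ge0 (A - proj j *m A *m proj j).
rewrite frobBl !frobBr (frobC (proj j *m A *m proj j) A) -frob_proj subrr subr0.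
by rewrite subr_ge0.
Qed.

(** The matrices P_j A P_j have mean [avg A] and mean square norm <A, avg A>; the difference of the
    two sides is their variance. *)
Lemma frob_avg_avg_le A : frob (avg A) (avg A) <= frob A (avg A).
Proof.
have : 0 <= n%:R^-1 * \sum_j frob (proj j *m A *m proj j - avg A)
                                  (proj j *m A *m proj j - avg A).
  by rewrite mulr_ge0 ?invr_ge0//; apply: sumr_ge0 => j _; exact: frob_ge0.
under eq_bigr do rewrite frobBl !frobBr -frob_proj.
rewrite !sumrB -frob_suml -!frob_sumr sumr_const card_ord !mulrBr.
have e X : n%:R^-1 * frob X (\sum_i proj i *m A *m proj i) = frob X (avg A).
  by rewrite -frobZr.
rewrite (frobC (\sum_i _) (avg A)) !e -[avg A *+ n]scaler_nat frobZr mulKf//.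
by rewrite subrr subr0 subr_ge0.
Qed.

(** Self-adjointness distributes the powers of Phi evenly over the two arguments. For even [k] the
    claim is then Phi <= 1 at Phi^h(Z), for odd [k] it is Phi^2 <= Phi there. *)
Lemma frob_iter_avg_decr k Z :
  frob Z (iter k.+1 avg Z) <= frob Z (iter k avg Z).
Proof.
have half p q : frob (iter p avg Z) (iter q avg Z) = frob Z (iter (p + q) avg Z).
  by elim: p q => // p IH q; rewrite iterS frob_avgC -iterS IH addSnnS.
rewrite -[k]odd_double_half -addnn; set h := k./2; case: (odd k).
- by have := frob_avg_avg_le (iter h avg Z); rewrite -!iterS !half !addnS !addSn.
- by have := frob_avg_le (iter h avg Z); rewrite -!iterS !half addnS.
Qed.

(** The row that reads off the noise of step [k]. It is 0 for [k >= N], hence the bounds by [N] in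
    what follows. *)
Definition tick k : 'rV[R]_N := \row_i (i == k :> nat)%:R.

(* After the draws [s] (latest first) the chain started from 0 at step [m] is at
   [S *m coef m s *m G], where [G] is the column of the first [N] noise terms. *)
Fixpoint coef m s : 'M[R]_(n, N) :=
  if s is j :: s' then
    if (size s' < m)%N then 0
    else proj j *m coef m s' + dir j *m tick (size s')
  else 0.

(** Noise of step [k] first enters at draw k + 1. This kills the cross terms in [coef_gram]. *)
Lemma coef_future m s k : (size s <= k)%N -> coef m s *m (tick k)^T = 0.
Proof.
elim: s => [|j s IH] /= sk; first by rewrite mul0mx.
case: ifP => _; first by rewrite mul0mx.
rewrite mulmxDl -!mulmxA IH ?mulmx0 ?add0r; last exact: ltnW.
rewrite (_ : _ *m (tick k)^T = 0) ?mulmx0//.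
apply/matrixP => a b; rewrite mxE big1 ?mxE// => i _; rewrite !mxE.
case: eqP => [->|]; last by rewrite mul0r.
by rewrite ltn_eqF// mulr0.
Qed.

Lemma coef_before m s : (size s <= m)%N -> coef m s = 0.
Proof. by case: s => [|j s]//= ->. Qed.

Lemma tick_norm k : (k < N)%N -> tick k *m (tick k)^T = 1%:M.
Proof.
move=> kN; apply/matrixP => a b; rewrite !ord1 mxE (bigD1 (Ordinal kN))//=.
transitivity (1 : R); last by rewrite mxE eqxx.
rewrite !mxE eqxx/= mulr1n mulr1 big1 ?addr0// => i ik; rewrite !mxE.
rewrite (_ : (i == k :> nat) = false) ?mul0r//.
by apply: contraNF ik => /eqP ik; apply/eqP/val_inj.
Qed.

Lemma coef_gram m s j : (size s < N)%N -> (m <= size s)%N ->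
  coef m (j :: s) *m (coef m (j :: s))^T =
  proj j *m (coef m s *m (coef m s)^T) *m proj j + dir j *m (dir j)^T.
Proof.
move=> sN ms; rewrite /= ltnNge ms/= linearD/= !trmx_mul proj_tr.
have tC : tick (size s) *m (coef m s)^T = 0.
  by apply: trmx_inj; rewrite trmx_mul trmxK coef_future// trmx0.
rewrite mulmxDr !mulmxDl -!mulmxA !(mulmxA (tick _)) tick_norm// mul1mx.
rewrite (mulmxA (coef m s) (tick (size s))^T) coef_future// tC.
by rewrite !mul0mx !mulmx0 addr0 add0r.
Qed.

(** This is U U^T <= 1: by [coef_gram] and induction, a step leads to at most P_j + v_j v_j^T =
    1. *)
Lemma coef_le1 m s (x : 'cV[R]_n) : (size s <= N)%N ->
  frob ((coef m s)^T *m x) ((coef m s)^T *m x) <= frob x x.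
Proof.
elim: s x => [|j s IH] x sN.
  by rewrite trmx0 mul0mx {1}/frob mul0mx mxtrace0; exact: frob_ge0.
have [sm|ms] := ltnP (size s) m.
  by rewrite /= sm trmx0 mul0mx {1}/frob mul0mx mxtrace0; exact: frob_ge0.
rewrite frob_mulmxl trmxK mulmxA frobC coef_gram// mulmxDl frobDl.
have {}IH := IH (proj j *m x) (ltnW sN).
rewrite -!mulmxA frob_mulmxl proj_tr mulmxA -mulmxA [X in X + _]frob_mulmxl.
apply: (@le_trans _ _ (frob (proj j *m x) (proj j *m x) +
  frob (dir j *m ((dir j)^T *m x)) x)).
  by rewrite lerD2r.
rewrite frob_mulmxl proj_tr mulmxA projK projE mulmxBl mul1mx frobBr.
by rewrite -mulmxA (frobC x (dir _ *m _)) subrK.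
Qed.

(** Step 0 is time -m: [coef 0] describes the shifted chain, and [coef m] the chain that starts at
    time 0, that is m steps later. *)
Definition dcoef m s := coef 0 s - coef m s.

Lemma dcoef_early m s j : (size s < N)%N -> (size s < m)%N ->
  dcoef m (j :: s) *m (dcoef m (j :: s))^T =
  proj j *m (dcoef m s *m (dcoef m s)^T) *m proj j + dir j *m (dir j)^T.
Proof.
move=> sN sm; rewrite /dcoef !(@coef_before m) ?subr0; [|exact: ltnW|by []].
exact: coef_gram.
Qed.

(** From step [m] on, both chains receive the same noise and it cancels. *)
Lemma dcoef_late m s j : (m <= size s)%N ->
  dcoef m (j :: s) = proj j *m dcoef m s.
Proof.
move=> ms; rewrite /dcoef /= ltnNge ms/= opprD addrACA subrr addr0.
by rewrite (mulmxBr (proj j)).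
Qed.

Definition dcov m k := mean k (fun s => dcoef m s *m (dcoef m s)^T).

Let Z := n%:R^-1 *: (S^T *m S).

Lemma mean_conj k j (F : seq 'I_n -> 'M[R]_n) :
  mean k (fun s => proj j *m F s *m proj j) = proj j *m mean k F *m proj j.
Proof.
rewrite /mean -scalemxAr -scalemxAl; congr (_ *: _).
by rewrite mulmx_sumr mulmx_suml.
Qed.

Lemma dcov_early m k : (k < N)%N -> (k < m)%N ->
  dcov m k.+1 = avg (dcov m k) + Z.
Proof.
move=> kN km; rewrite /dcov mean_cons /avg /Z -sum_dir -scalerDr -big_split.
congr (_ *: _); apply: eq_bigr => j _ /=.
rewrite -mean_conj -[X in _ + X](mean_cst k) -meanD.
by apply: eq_mean => s sk; rewrite dcoef_early// sk.
Qed.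

Lemma dcov_late m k : (m <= k)%N -> dcov m k.+1 = avg (dcov m k).
Proof.
move=> mk; rewrite /dcov mean_cons /avg; congr (_ *: _); apply: eq_bigr => j _.
rewrite -mean_conj; apply: eq_mean => s sk.
by rewrite dcoef_late ?sk// trmx_mul proj_tr !mulmxA.
Qed.

Lemma dcovE m i : (m <= N)%N ->
  dcov m (i + m) = \sum_(0 <= l < m) iter (i + l) avg Z.
Proof.
move=> mN; have early k : (k <= m)%N -> dcov m k = \sum_(0 <= l < k) iter l avg Z.
  elim: k => [_|k IH km].
    by rewrite big_nil /dcov mean0 /dcoef /= subr0 mul0mx.
  rewrite dcov_early//; last exact: leq_trans mN.
  rewrite big_nat_recl//= IH ?(ltnW km)// avg_sum addrC.
  by congr (_ + _); apply: eq_bigr.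
elim: i => [|i IH]; first exact: early.
rewrite addSn dcov_late ?leq_addl// IH avg_sum.
by apply: eq_bigr.
Qed.

Lemma avg1 : avg 1%:M = 1%:M - Z.
Proof.
rewrite /avg /Z -sum_dir; under eq_bigr do rewrite mulmx1 projK projE.
rewrite sumrB sumr_const card_ord scalerBr -[1%:M *+ n]scaler_nat.
by rewrite scalerA mulVf// scale1r.
Qed.

(* [dsq m i] is E |X_{i,m} - X_i|^2, and [dtrace m i] the same quantity in the
   coordinates Y of X = S Y. *)
Definition dtrace m i := frob 1%:M (dcov m (i + m)).
Definition dsq m i := frob (S^T *m S) (dcov m (i + m)).

Let gramE : S^T *m S = n%:R *: Z.
Proof. by rewrite /Z scalerA divff// scale1r. Qed.

(** Move Phi from [B] to the identity and use Phi(1) = 1 - Z. This is what makes [dsq] a telescoping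
    difference of traces. *)
Lemma frobZ1 B : frob Z B = frob 1%:M B - frob 1%:M (avg B).
Proof. by rewrite -frob_avgC avg1 frobBl opprB addrC subrK. Qed.

Lemma dsq_trace m i : dsq m i = n%:R * (dtrace m i - dtrace m i.+1).
Proof.
by rewrite /dsq gramE frobZl frobZ1 /dtrace addSn dcov_late ?leq_addl.
Qed.

Lemma frob_mean k B (F : seq 'I_n -> 'M[R]_n) :
  frob B (mean k F) = mean k (fun s => frob B (F s) : R^o).
Proof. by rewrite /mean frobZr frob_sumr. Qed.

Lemma dtrace_ge0 m i : 0 <= dtrace m i.
Proof.
rewrite /dtrace /dcov frob_mean -[X in X <= _](@mean_cst R^o (i + m)).
apply: ler_mean => s _; rewrite frobC frob_mulmxr mul1mx trmxK; exact: frob_ge0.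
Qed.

(** At time 0 the second chain is still 0, so the trace is that of U U^T <= 1, computed on the basis
    vectors. *)
Lemma dtrace0_le m : (m <= N)%N -> dtrace m 0 <= n%:R.
Proof.
move=> mN; rewrite /dtrace /dcov frob_mean -[X in _ <= X](@mean_cst R^o m).
apply: ler_mean => s sm; rewrite /dcoef (@coef_before m) ?sm// subr0.
rewrite frobC frob_mulmxr mul1mx trmxK -frob_trmx frob_col.
rewrite -[n in leRHS]card_ord -sumr_const; apply: ler_sum => j _.
rewrite colE; apply: le_trans (coef_le1 _ _ _) _; first by rewrite sm.
by rewrite frobE (bigD1 j)//= big_ord1 !mxE !eqxx mulr1 big1 ?addr0// => a aj;
  rewrite big_ord1 !mxE (negbTE aj) mulr0.
Qed.

Lemma dsq_decr m i : (m <= N)%N -> dsq m i.+1 <= dsq m i.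
Proof.
move=> mN; have e B : frob (S^T *m S) B = n%:R * frob Z B by rewrite gramE frobZl.
rewrite /dsq !dcovE// !e ler_wpM2l// !frob_sumr.
by apply: ler_sum => l _; rewrite addSn frob_iter_avg_decr.
Qed.

Lemma dsq_le_inv m i : (m <= N)%N -> dsq m i <= n%:R ^+ 2 / i.+1%:R.
Proof.
move=> mN; rewrite ler_pdivlMr// mulrC.
have -> : i.+1%:R * dsq m i = \sum_(l < i.+1) dsq m i.
  by rewrite sumr_const card_ord mulr_natl.
apply: (@le_trans _ _ (\sum_(l < i.+1) dsq m l)).
  apply: ler_sum => l _; have : (l <= i)%N by rewrite -ltnS.
  move: (nat_of_ord l) => {}l.
  elim: i => [|i IH]; first by rewrite leqn0 => /eqP->.
  rewrite leq_eqVlt => /predU1P[->//|li].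
  by apply: le_trans (IH li); exact: dsq_decr.
have -> : \sum_(l < i.+1) dsq m l = n%:R * (dtrace m 0 - dtrace m i.+1).
  elim: i => [|i IH]; first by rewrite big_ord1 dsq_trace.
  by rewrite big_ord_recr/= IH dsq_trace -mulrDr addrA subrK.
rewrite expr2 ler_wpM2l// lerBlDr (le_trans (dtrace0_le mN))// lerDl.
exact: dtrace_ge0.
Qed.

(** * Eigenvalue bounds and geometric decay *)

Section spectrum.
Variables lmin lmax : R.
Hypothesis S_unit : S \in unitmx.
Hypothesis S_min : smallest_eigenvalue (S *m S^T) lmin.
Hypothesis S_max : largest_eigenvalue (S *m S^T) lmax.

Lemma smallest_eigenvalue_gt0 : 0 < lmin.
Proof.
have [/eigenvalueP[v vS v0] _] := S_min.
have vv0 : 0 < frob v v.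
  by rewrite lt_neqAle frob_ge0 andbT eq_sym; apply: contra v0 => /eqP/frob_eq0->.
have : 0 < frob (v *m S) (v *m S).
  rewrite lt_neqAle frob_ge0 andbT eq_sym; apply: contra v0 => /eqP/frob_eq0 vS0.
  by rewrite -[v](mulmxK S_unit) vS0 mul0mx.
by rewrite frob_mulmxr -mulmxA vS frobZr pmulr_lgt0.
Qed.

(** The form at a basis vector is a diagonal entry, which is 1. *)
Lemma smallest_eigenvalue_le1 : lmin <= 1.
Proof.
pose j := Ordinal n_gt0.
have := @rayleigh_ge R n (S *m S^T) lmin (delta_mx j 0) _ S_min.
rewrite trmx_mul trmxK frob_quad => /(_ erefl).
have -> : frob (delta_mx j 0 : 'cV[R]_n) (delta_mx j 0) = 1.
  rewrite frobE (bigD1 j)//= big_ord1 !mxE !eqxx mulr1 big1 ?addr0// => a aj.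
  by rewrite big_ord1 !mxE (negbTE aj) mulr0.
rewrite mulr1 => /le_trans; apply; rewrite -colE frobE (bigD1 j)//= big_ord1.
rewrite [X in X * _]mxE S_row !mxE !eqxx mulr1 big1 ?addr0// => a aj.
by rewrite big_ord1 [X in _ * X]mxE (negbTE aj) mulr0.
Qed.

Lemma dsq_mean m i :
  dsq m i = mean (i + m) (fun s => frob (S *m dcoef m s) (S *m dcoef m s) : R^o).
Proof.
rewrite /dsq /dcov frob_mean; apply: eq_mean => s _.
by rewrite frobC frob_mulmxr trmxK [RHS]frob_mulmxl mulmxA.
Qed.

Lemma dtrace_mean m i :
  dtrace m i = mean (i + m) (fun s => frob (dcoef m s) (dcoef m s) : R^o).
Proof.
rewrite /dtrace /dcov frob_mean; apply: eq_mean => s _.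
by rewrite frobC frob_mulmxr mul1mx trmxK.
Qed.

Lemma meanZ k c (F : seq 'I_n -> R^o) :
  c * mean k F = mean k (fun s => c * F s : R^o).
Proof. by rewrite /mean /GRing.scale/= mulrCA mulr_sumr. Qed.

Let gram_sym : (S^T *m S)^T = S^T *m S.
Proof. by rewrite trmx_mul trmxK. Qed.

Lemma frob_mulS p (A : 'M[R]_(n, p)) :
  frob (S *m A) (S *m A) = \sum_j quad_form (S^T *m S) (col j A).
Proof.
rewrite frob_col; apply: eq_bigr => j _.
by rewrite frob_quad -mulmxA frob_mulmxl trmxK !colE mulmxA.
Qed.

Lemma dsq_ge m i : lmin * dtrace m i <= dsq m i.
Proof.
have Smin : smallest_eigenvalue (S^T *m S) lmin.
  have [lS Sl] := S_min; split; first by rewrite eigenvalue_gramC.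
  by move=> a; rewrite eigenvalue_gramC//; exact: Sl.
rewrite dsq_mean dtrace_mean meanZ; apply: ler_mean => s _.
rewrite frob_mulS [in leLHS]frob_col mulr_sumr.
by apply: ler_sum => j _; exact: rayleigh_ge.
Qed.

Lemma dsq_le m i : dsq m i <= lmax * dtrace m i.
Proof.
have Smax : largest_eigenvalue (S^T *m S) lmax.
  have [lS Sl] := S_max; split; first by rewrite eigenvalue_gramC.
  by move=> a; rewrite eigenvalue_gramC//; exact: Sl.
rewrite dsq_mean dtrace_mean meanZ; apply: ler_mean => s _.
rewrite frob_mulS [in leRHS]frob_col mulr_sumr.
by apply: ler_sum => j _; exact: rayleigh_le.
Qed.

Lemma contraction_ge0 : 0 <= 1 - lmin / n%:R.
Proof.
rewrite subr_ge0 ler_pdivrMr ?ltr0n// mul1r.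
by rewrite (le_trans smallest_eigenvalue_le1)// ler1n.
Qed.

Lemma dsq_le_geom m i : (m <= N)%N ->
  dsq m i <= lmax * n%:R * (1 - lmin / n%:R) ^+ i.
Proof.
move=> mN; apply: le_trans (dsq_le m i) _.
have lmax0 : 0 <= lmax.
  by rewrite (le_trans (ltW smallest_eigenvalue_gt0))//; apply: S_max.2; exact: S_min.1.
rewrite -mulrA ler_wpM2l//.
elim: i => [|i IH]; first by rewrite expr0 mulr1; exact: dtrace0_le.
(* The trace loses q_i / n at each step, and q_i is at least [lmin] times the trace; this is the
   origin of the ratio 1 - lmin / n. *)
have -> : dtrace m i.+1 = dtrace m i - dsq m i / n%:R.
  by rewrite dsq_trace mulrC mulKf// opprB addrC subrK.
apply: (@le_trans _ _ ((1 - lmin / n%:R) * dtrace m i)).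
  by rewrite mulrBl mul1r lerD2l lerN2 mulrAC ler_pM2r ?invr_gt0 ?ltr0n// dsq_ge.
by rewrite exprS mulrCA ler_wpM2l// contraction_ge0.
Qed.

End spectrum.

End random_projections.

(** * Linear combinations of independent standard Gaussian variables *)

Lemma countable_bigcup_measurable d (T : measurableType d) (C : countType)
    (Q : set C) (F : C -> set T) :
  (forall p, measurable (F p)) -> measurable (\bigcup_(p in Q) F p).
Proof.
move=> mF.
have -> : \bigcup_(p in Q) F p =
    \bigcup_k (if unpickle k is Some p then if p \in Q then F p else set0 else set0).
  apply/seteqP; split => w.
    by move=> [p Qp Fp]; exists (pickle p) => //; rewrite pickleK mem_set.
  move=> [k _]; case: (unpickle k) => // p.
  by case: ifPn => // /set_mem Qp Fp; exists p.
apply: bigcupT_measurable => k; case: unpickle => // p.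
by case: ifP.
Qed.

Lemma bigcap_seq_cons (T : Type) (J : eqType) (k : J) (r : seq J)
    (F : J -> set T) :
  \bigcap_(j in [set` k :: r]) F j = F k `&` \bigcap_(j in [set` r]) F j.
Proof.
apply/seteqP; split => w.
  by move=> Fw; split=> [|j /= jr]; apply: Fw => /=; rewrite in_cons ?eqxx// jr orbT.
by move=> [Fk Fr] j /=; rewrite in_cons => /predU1P[->//|]; exact: Fr.
Qed.

Section random_vectors.
Context {R : realType} d (T : measurableType d).

Lemma measurable_coord n (i : 'I_n) :
  measurable_fun [set: borel_vec R n] (fun v : 'cV[R]_n => v i 0).
Proof.
apply: (measurability _ (RGenOpens.measurableE R)) => _ [_ [a [b ->]] <-].
rewrite setTI; apply: sub_sigma_algebra.
have /continuousP : continuous (fun v : 'cV[R]_n => v i 0 : R).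
  exact: coord_continuous.
by apply; exact: interval_open.
Qed.

(** For the converse, balls of the sup norm are boxes, so an open set is the countable union of the
    rational boxes that it contains. *)
Lemma random_vectorP n (X : T -> 'cV[R]_n) :
  random_vector X <-> forall i, measurable_fun setT (fun w => X w i 0).
Proof.
split=> [mX i|mX].
  exact: (measurableT_comp (measurable_coord i) mX).
apply: (@measurability _ _ T (borel_vec R n) setT X open) => //.
move=> _ [U oU <-]; rewrite setTI.
pose box (p : {ffun 'I_n -> rat * rat}) :=
  [set v : 'cV[R]_n | forall i, v i 0 \in `]ratr (p i).1, ratr (p i).2[].
have -> : U = \bigcup_(p in [set p | box p `<=` U]) box p.
  apply/seteqP; split => [v Uv|v [p /= pU vp]]; last exact: pU.
  move: oU; rewrite openE => /(_ _ Uv) /nbhs_ballP[r /= r0 rU].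
  have /choice[p pP] : forall i : 'I_n, exists p : rat * rat,
      [/\ ratr p.1 \in `]v i 0 - r, v i 0[ & ratr p.2 \in `]v i 0, v i 0 + r[].
    move=> i.
    have [a aP] := @rat_in_itvoo R (v i 0 - r) (v i 0) ltac:(by rewrite ltrBlDr ltrDl).
    have [b bP] := @rat_in_itvoo R (v i 0) (v i 0 + r) ltac:(by rewrite ltrDl).
    by exists (a, b).
  exists [ffun i => p i] => /=.
    move=> u up; apply: rU; split => // i j; rewrite ord1.
    have := up i; rewrite ffunE in_itv/= => /andP[pu up'].
    have [] := pP i; rewrite !in_itv/= => /andP[p1 p2] /andP[p3 p4].
    by rewrite /ball/= ltr_norml; apply/andP; split; lra.
  move=> i; rewrite ffunE in_itv/=.
  by have [] := pP i; rewrite !in_itv/= => /andP[_ ->] /andP[-> _].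
rewrite preimage_bigcup; apply: countable_bigcup_measurable => p.
have -> : X @^-1` box p =
    \bigcap_(i in [set: 'I_n]) ((fun w => X w i 0) @^-1` `]ratr (p i).1, ratr (p i).2[).
  by apply/seteqP; split => w /= h i; have := h i; [move=> ? _|apply].
apply: fin_bigcap_measurable; first exact: finite_finset.
by move=> i _; rewrite -[X in measurable X]setTI; exact: mX.
Qed.

End random_vectors.

(** * Laws of sums of independent variables *)

Section laws.
Context {R : realType}.
Local Open Scope ereal_scope.

Lemma ge0_integral_same_law d1 d2 d3 (T1 : measurableType d1)
    (T2 : measurableType d2) (S : measurableType d3)
    (m1 : {measure set T1 -> \bar R}) (m2 : {measure set T2 -> \bar R})
    (X1 : T1 -> S) (X2 : T2 -> S) (h : S -> \bar R) :
    measurable_fun setT X1 -> measurable_fun setT X2 ->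
    (forall B, measurable B -> m1 (X1 @^-1` B) = m2 (X2 @^-1` B)) ->
    measurable_fun setT h -> (forall x, 0 <= h x) ->
  \int[m1]_w h (X1 w) = \int[m2]_w h (X2 w).
Proof.
move=> mX1 mX2 XE mh h0.
have := ge0_integral_pushforward mX1 m1 measurableT mh (in1W h0).
have := ge0_integral_pushforward mX2 m2 measurableT mh (in1W h0).
rewrite !preimage_setT => <- <-.
by apply: eq_measure_integral => B mB _; exact: XE.
Qed.

Context d (T : measurableType d) (P : probability T R).

Lemma ge0_integral_mrestr (A : set T) (mA : measurable A) (f : T -> \bar R) :
    measurable_fun setT f -> (forall x, 0 <= f x) ->
  \int[mrestr P mA]_w f w = \int[P]_(w in A) f w.
Proof.
move=> mf f0; rewrite (@ge0_integral_density _ _ _ P _ \1_A)//.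
- rewrite [RHS]integral_mkcond; apply: eq_integral => w _.
  by rewrite epatch_indic.
- by move=> B mB; rewrite integral_indic// setIC.
Qed.

(** Under [P] restricted to [A], the law of [Y] is P(A) times its law under [P]. *)
Lemma ge0_integral_indep (A : set T) (Y : T -> R) : measurable A ->
    measurable_fun setT Y -> (forall w, 0 <= Y w)%R ->
    (forall B, measurable B -> P (A `&` Y @^-1` B) = P A * P (Y @^-1` B)) ->
  \int[P]_(w in A) (Y w)%:E = P A * \int[P]_w (Y w)%:E.
Proof.
move=> mA mY Y0 AY.
have PAfin : P A = (fine (P A))%:E by rewrite fineK// fin_num_measure.
pose k : {nonneg R} := NngNum (fine_ge0 (measure_ge0 P A)).
rewrite -(ge0_integral_mrestr mA)//; last exact/measurable_EFinP.
have mY' : measurable_fun setT (EFin \o Y) by exact/measurable_EFinP.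
have <- : \int[mscale k P]_w (Y w)%:E = P A * \int[P]_w (Y w)%:E.
  rewrite PAfin; apply: (ge0_integral_mscale _ measurableT k mY') => w _ /=.
  by rewrite lee_fin.
(* The transfer of laws wants an integrand that is nonnegative on the whole line, hence the absolute
   value. *)
have YE w : (Y w)%:E = `|Y w|%:E by rewrite ger0_norm.
under eq_integral do rewrite YE.
under [RHS]eq_integral do rewrite YE.
apply: (@ge0_integral_same_law _ _ _ _ _ _ _ _ Y Y (fun x => `|x|%:E)) => //.
  move=> B mB; change (P (Y @^-1` B `&` A) = (fine (P A))%:E * P (Y @^-1` B)).
  by rewrite -PAfin setIC AY.
by apply/measurable_EFinP; exact: normr_measurable.
Qed.

(** On [E] the joint law of (X, Y) agrees on rectangles with p times the product of [m1] and [m2],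
    so it equals it by uniqueness of the product measure. *)
Lemma indep_add_law (X Y : T -> R) (E : set T) (p : {nonneg R})
    (m1 m2 : probability (measurableTypeR R) R) (A : set R) :
    measurable_fun setT X -> measurable_fun setT Y -> measurable E ->
    (forall A B, measurable A -> measurable B ->
      P (X @^-1` A `&` Y @^-1` B `&` E) = p%:num%:E * m1 A * m2 B) ->
    measurable A ->
  P ((fun w => X w + Y w)%R @^-1` A `&` E) =
  p%:num%:E * \int[m1]_x m2 ((fun y => x + y)%R @^-1` A).
Proof.
move=> mX mY mE XYE mA.
pose XY w : measurableTypeR R * measurableTypeR R := (X w, Y w).
have mXY : measurable_fun setT XY by exact/measurable_fun_pair.
pose D := (fun z : R * R => z.1 + z.2)%R @^-1` A.
have mD : measurable D.
  by rewrite -[D]setTI; exact: measurable_funD.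
transitivity ((mscale p m1 \x m2) D); last first.
  rewrite /product_measure1 ge0_integral_mscale//; last first.
    exact: measurable_fun_xsection.
  congr (_ * _); apply: eq_integral => x _ /=; congr (m2 _).
  by apply/seteqP; split => y; rewrite /xsection/= inE.
apply/esym.
exact: (product_measure_unique (m' := pushforward (mrestr P mE) XY)).
Qed.

(* The extra factors over [r'] carry the independence from the remaining
   coordinates through the induction on [r]. *)
Lemma indep_lin_law (J : eqType) (g : J -> T -> R) (c : J -> R) (r r' : seq J)
    (B : J -> set R) (A : set R) :
    (forall j, has_law P (g j) (normal_prob 0 1)) -> mutually_independent P g ->
    uniq (r ++ r') -> (forall j, measurable (B j)) -> measurable A ->
  P ((fun w => \sum_(j <- r) c j * g j w)%R @^-1` A `&`
     \bigcap_(j in [set` r']) (g j @^-1` B j)) =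
  centered_gaussian (Num.sqrt (\sum_(j <- r) c j ^+ 2)%R) A *
  \prod_(j <- r') P (g j @^-1` B j).
Proof.
move=> gN gI; elim: r r' B A => [|k r IH] r' B A ur mB mA.
  rewrite big_nil sqrtr0 /centered_gaussian eqxx/= diracE -gI//.
  under eq_fun do rewrite big_nil.
  have [A0|A0] := boolP (0%R \in A).
    rewrite (_ : _ @^-1` A = setT) ?setTI ?mul1e//.
    by apply/seteqP; split => // w _ /=; rewrite inE in A0.
  rewrite (_ : _ @^-1` A = set0) ?set0I ?measure0 ?mul0e//.
  by apply/seteqP; split => // w /=; rewrite notin_setE in A0.
have mg j : measurable_fun setT (g j) by have [] := gN j.
have ur2 : uniq (r ++ (k :: r')) by have := ur; rewrite -cat1s -catA uniq_catCA cat1s.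
have kr' : k \notin r'.
  by move: ur; rewrite /= mem_cat negb_or => /andP[/andP[]].
have pfin : \prod_(j <- r') P (g j @^-1` B j) = (fine (\prod_(j <- r') P (g j @^-1` B j)))%:E.
  rewrite fineK//; apply: (big_ind (fun x : \bar R => x \is a fin_num)) => //.
    by move=> x y; exact: fin_numM.
  by move=> j _; rewrite fin_num_measure// -[X in measurable X]setTI; exact: mg.
have p0 : (0 <= fine (\prod_(j <- r') P (g j @^-1` B j)))%R.
  rewrite fine_ge0//; apply: (big_ind (fun x : \bar R => 0 <= x)) => // x y.
  exact: mule_ge0.
have mc : measurable_fun setT (fun w => c k * g k w)%R by exact: measurable_funM.
have mlin : measurable_fun setT (fun w => \sum_(j <- r) c j * g j w)%R.
  by apply: measurable_sum => j; exact: measurable_funM.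
under eq_fun do rewrite big_cons addrC.
rewrite (@indep_add_law _ _ _ (NngNum p0)
  (centered_gaussian (Num.sqrt (\sum_(j <- r) c j ^+ 2)%R))
  (centered_gaussian `|c k|))//.
- rewrite centered_gaussian_conv ?sqrtr_ge0// sqr_sqrtr ?sumr_ge0//; last first.
    by move=> j _; rewrite sqr_ge0.
  by rewrite /= -pfin muleC big_cons addrC real_normK ?num_real.
- apply: fin_bigcap_measurable => //.
  by move=> j _; rewrite -[X in measurable X]setTI; exact: mg.
- move=> A1 B1 mA1 mB1 /=; rewrite -pfin.
  have mB1' : measurable ((fun x => c k * x)%R @^-1` B1).
    by rewrite -[X in measurable X]setTI; exact: measurable_funM.
  (* The induction hypothesis is applied with [k] moved into the remaining coordinates, where it
     carries the event that c_k g_k lies in [B1]. *)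
  pose B' j := if j == k then (fun x => c k * x)%R @^-1` B1 else B j.
  have := IH (k :: r') B' A1 ur2 _ mA1.
  rewrite big_cons bigcap_seq_cons (_ : B' k = (fun x => c k * x)%R @^-1` B1);
    last by rewrite /B' eqxx.
  have -> : \prod_(j <- r') P (g j @^-1` B' j) = \prod_(j <- r') P (g j @^-1` B j).
    rewrite big_seq [RHS]big_seq; apply: eq_bigr => j jr'.
    by rewrite /B'; case: eqP => // jk; rewrite -jk jr' in kr'.
  have -> : \bigcap_(j in [set` r']) (g j @^-1` B' j) = \bigcap_(j in [set` r']) (g j @^-1` B j).
    apply: eq_bigcapr => j /= jr'.
    by rewrite /B'; case: eqP => // jk; rewrite -jk jr' in kr'.
  rewrite setIA => -> //; last by move=> j; rewrite /B'; case: eqP.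
  rewrite (gN k).2// centered_gaussian_scale//.
  by rewrite muleCA [RHS]muleC [in RHS](muleC _ (centered_gaussian _ _)).
Qed.

Lemma measurable_lin (J : eqType) (g : J -> T -> R) (c : J -> R) (r : seq J) :
  (forall j, measurable_fun setT (g j)) ->
  measurable_fun setT (fun w => \sum_(j <- r) c j * g j w)%R.
Proof. by move=> mg; apply: measurable_sum => j; exact: measurable_funM. Qed.

Lemma lin_law (J : finType) (g : J -> T -> R) (c : J -> R) (A : set R) :
    (forall j, has_law P (g j) (normal_prob 0 1)) -> mutually_independent P g ->
    measurable A ->
  P ((fun w => \sum_j c j * g j w)%R @^-1` A) =
  centered_gaussian (Num.sqrt (\sum_j c j ^+ 2)%R) A.
Proof.
move=> gN gI mA.
have := @indep_lin_law _ g c (index_enum J) [::] (fun=> setT) A gN gI.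
by rewrite big_nil mule1 set_nil bigcap_set0 setIT cats0 index_enum_uniq; apply.
Qed.

Lemma centered_gaussian_second_moment (s : R) : (0 <= s)%R ->
  \int[centered_gaussian s]_x ((x : R) ^+ 2)%:E = (s ^+ 2)%:E.
Proof.
move=> s0.
have msq : measurable_fun setT (fun x : measurableTypeR R => ((x : R) ^+ 2)%:E).
  by apply/measurable_EFinP; exact: measurable_funX.
transitivity (\int[normal_prob 0 1]_x ((s * x : R) ^+ 2)%:E).
  apply: (@ge0_integral_same_law _ _ _ (measurableTypeR R) (measurableTypeR R)
    (measurableTypeR R) (centered_gaussian s) (normal_prob 0 1) id
    (fun x : R => s * x)%R (fun x : R => (x ^+ 2)%:E)) => //.
  - exact: measurable_funM.
  - by move=> B mB; have := centered_gaussian_scale s mB; rewrite ger0_norm// => ->.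
  - by move=> x; rewrite lee_fin sqr_ge0.
under eq_integral do rewrite exprMn EFinM.
rewrite ge0_integralZl//; last 2 first.
- by move=> x _; rewrite lee_fin sqr_ge0.
- by rewrite lee_fin sqr_ge0.
by rewrite normal_prob_second_moment mule1.
Qed.

Section linear_combinations.
Context (J : finType) (g : J -> T -> R).
Hypothesis gN : forall j, has_law P (g j) (normal_prob 0 1).
Hypothesis gI : mutually_independent P g.
Implicit Types a b : J -> R.

Let mg j : measurable_fun setT (g j). Proof. by have [] := gN j. Qed.

Definition lin a w : R := (\sum_j a j * g j w)%R.

Let mlin a : measurable_fun setT (lin a).
Proof. exact: measurable_lin. Qed.

Lemma integral_lin_sqr a :
  \int[P]_w (lin a w ^+ 2)%:E = (\sum_j a j ^+ 2)%R%:E.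
Proof.
have a0 : (0 <= \sum_j a j ^+ 2)%R by apply: sumr_ge0 => j _; exact: sqr_ge0.
rewrite -[in RHS](sqr_sqrtr a0) -centered_gaussian_second_moment ?sqrtr_ge0//.
apply: (@ge0_integral_same_law _ _ _ T (measurableTypeR R) (measurableTypeR R)
  P (centered_gaussian _) (lin a) id (fun x : R => (x ^+ 2)%:E)) => //.
- exact: mlin.
- by move=> B mB; exact: lin_law.
- by apply/measurable_EFinP; exact: measurable_funX.
- by move=> x; rewrite lee_fin sqr_ge0.
Qed.

Lemma integrable_lin_sqr a : P.-integrable setT (fun w => (lin a w ^+ 2)%:E).
Proof.
apply/integrableP; split.
  by apply/measurable_EFinP; exact: measurable_funX.
under eq_integral do rewrite gee0_abs ?lee_fin ?sqr_ge0//.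
by rewrite integral_lin_sqr ltry.
Qed.

(* By symmetry of the law. *)
Lemma integral_lin a : \int[P]_w (lin a w)%:E = 0.
Proof.
have sgn h : measurable_fun setT h -> (forall x, 0 <= h x) ->
    \int[P]_w h (lin a w) = \int[P]_w h (- lin a w)%R.
  move=> mh h0.
  apply: (@ge0_integral_same_law _ _ _ _ _ _ P P (lin a) (fun w => - lin a w)%R h) => //.
    exact: measurable_funN.
  move=> B mB; have -> : (fun w => - lin a w)%R = lin (fun j => - a j)%R.
    apply/funext => w; rewrite /lin -sumrN.
    by apply: eq_bigr => j _; rewrite mulNr.
  apply: etrans (lin_law a gN gI mB) _.
  apply: etrans (esym (lin_law (fun j => - a j)%R gN gI mB)).
  by under [in RHS]eq_bigr do rewrite sqrrN.
(* Integrability comes from |x| <= 1 + x^2; it allows the positive and negative parts to be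
   subtracted. *)
have sum1 : P.-integrable setT (fun w => 1 + (lin a w ^+ 2)%:E).
  apply: integrableD => //; last exact: integrable_lin_sqr.
  exact: finite_measure_integrable_cst.
have int_lin : P.-integrable setT (EFin \o lin a).
  apply: (le_integrable measurableT _ _ sum1); first exact/measurable_EFinP.
  move=> w _; rewrite -[1 + _]/((1 + lin a w ^+ 2)%:E) /= lee_fin.
  rewrite [leRHS]ger0_norm ?addr_ge0 ?sqr_ge0//.
  rewrite ler_norml; have := sqr_ge0 (lin a w - 1)%R.
  by have := sqr_ge0 (lin a w + 1)%R; rewrite !expr2 => h1 h2; apply/andP; split; lra.
rewrite integralE.
have -> : \int[P]_w (fun w => (lin a w)%:E)^\+ w = \int[P]_w (fun w => (lin a w)%:E)^\- w.
  under eq_integral do rewrite funeposE.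
  under [RHS]eq_integral do rewrite funenegE -EFinN.
  apply: (sgn (fun x => maxe x%:E 0)); last by move=> x; rewrite le_max lexx orbT.
  by apply: measurable_maxe => //; exact/measurable_EFinP.
by rewrite subee// integrable_neg_fin_num.
Qed.

(** Polarization of [integral_lin_sqr]. *)
Lemma integral_lin_mul a b :
  \int[P]_w (lin a w * lin b w)%:E = (\sum_j a j * b j)%R%:E.
Proof.
have lD w : lin (fun j => a j + b j)%R w = (lin a w + lin b w)%R.
  by rewrite /lin -big_split; apply: eq_bigr => j _; rewrite mulrDl.
have lB w : lin (fun j => a j - b j)%R w = (lin a w - lin b w)%R.
  by rewrite /lin -sumrB; apply: eq_bigr => j _; rewrite mulrBl.
have e w : (lin a w * lin b w)%:E = (4^-1)%:E *
    ((lin (fun j => a j + b j)%R w ^+ 2)%:E - (lin (fun j => a j - b j)%R w ^+ 2)%:E).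
  by rewrite lD lB -EFinB -EFinM; congr EFin; field.
under eq_integral do rewrite e.
rewrite integralZl//; last first.
  by apply: integrableB => //; exact: integrable_lin_sqr.
rewrite integralB//; [|exact: integrable_lin_sqr|exact: integrable_lin_sqr].
rewrite !integral_lin_sqr -EFinB -EFinM -sumrB mulr_sumr; congr EFin.
by apply: eq_bigr => j _; field.
Qed.

End linear_combinations.

End laws.

(** * The chain given the draws *)

Section random_vector_operations.
Context {R : realType} d (T : measurableType d).

Definition gvec N (g : 'I_N -> T -> R) w : 'cV[R]_N := \col_i g i w.

Lemma mulmx_gvec N (g : 'I_N -> T -> R) p (A : 'M[R]_(p, N)) i w :
  (A *m gvec g w) i 0 = lin g (A i) w.
Proof. by rewrite mxE; apply: eq_bigr => j _; rewrite mxE. Qed.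

Lemma random_vector_mulmx_gvec N (g : 'I_N -> T -> R) p (A : 'M[R]_(p, N)) :
  (forall j, measurable_fun setT (g j)) -> random_vector (fun w => A *m gvec g w).
Proof.
move=> mg; apply/random_vectorP => i; under eq_fun do rewrite mulmx_gvec.
exact: measurable_lin.
Qed.

Lemma measurable_diff_sqr p (f : 'cV[R]_p -> R) (X Y : T -> 'cV[R]_p) :
  borel_function f -> random_vector X -> random_vector Y ->
  measurable_fun setT (fun w => (f (X w) - f (Y w)) ^+ 2).
Proof.
move=> mf mX mY; apply: measurable_funX; apply: measurable_funB.
- exact: (measurableT_comp mf mX).
- exact: (measurableT_comp mf mY).
Qed.

End random_vector_operations.

Section gaussian_images.
Context {R : realType} d (T : measurableType d) (P : probability T R).
Context (N : nat) (g : 'I_N -> T -> R).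
Hypothesis gN : forall j, has_law P (g j) (normal_prob 0 1).
Hypothesis gI : mutually_independent P g.

Let mg j : measurable_fun setT (g j). Proof. by have [] := gN j. Qed.

Lemma gaussian_vector_mulmx p (A : 'M[R]_(p, N)) :
  gaussian_vector P (fun w => A *m gvec g w).
Proof.
split=> [|a]; first exact: random_vector_mulmx_gvec.
exists 0, (Num.sqrt (\sum_j (a^T *m A) 0 j ^+ 2)); split; first exact: sqrtr_ge0.
have -> : (fun w => (a^T *m (A *m gvec g w)) 0 0) = lin g ((a^T *m A) 0).
  by apply/funext => w; rewrite mulmxA mulmx_gvec.
split; first exact: measurable_lin.
by move=> B mB; rewrite -centered_gaussianE; exact: lin_law.
Qed.

Lemma expectation_mulmx_gvec p (A : 'M[R]_(p, N)) i :
  ('E_P[fun w => (A *m gvec g w) i 0%R] = 0)%E.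
Proof.
rewrite unlock; under eq_integral do rewrite mulmx_gvec.
exact: integral_lin.
Qed.

Lemma Cov_mulmx p (A : 'M[R]_(p, N)) : Cov P (fun w => A *m gvec g w) = A *m A^T.
Proof.
apply/matrixP => i j; rewrite !mxE unlock !expectation_mulmx_gvec/= unlock.
under eq_integral.
  move=> w _.
  rewrite (_ : _ w = lin g (A i) w * lin g (A j) w)%R; last first.
    by rewrite !fctE/= !subr0 !mulmx_gvec.
  over.
by rewrite integral_lin_mul//=; apply: eq_bigr => k _; rewrite mxE.
Qed.

Lemma expectation_sqr_norm p (A : 'M[R]_(p, N)) :
  ('E_P[fun w => (euclidean_norm (A *m gvec g w) ^+ 2)%R] = (frob A A)%:E)%E.
Proof.
rewrite unlock.
have e w : (euclidean_norm (A *m gvec g w) ^+ 2)%:E =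
    (\sum_i (lin g (A i) w ^+ 2)%:E)%E.
  rewrite sqr_sqrtr; last by apply: sumr_ge0 => i _; exact: sqr_ge0.
  by rewrite sumEFin; congr EFin; apply: eq_bigr => i _; rewrite mulmx_gvec.
under eq_integral do rewrite e.
rewrite ge0_integral_sum//; last 2 first.
- by move=> i; apply/measurable_EFinP/measurable_funX; exact: measurable_lin.
- by move=> i w _; rewrite lee_fin sqr_ge0.
rewrite frobE -sumEFin; apply: eq_bigr => i _.
by rewrite integral_lin_sqr//; congr EFin; apply: eq_bigr => j _; rewrite expr2.
Qed.

Lemma loewner_le_gram p q (A : 'M[R]_(p, q)) (V : 'M[R]_p) :
  V^T = V -> (forall x, frob (A^T *m x) (A^T *m x) <= quad_form V x) ->
  loewner_le (A *m A^T) V.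
Proof.
move=> Vsym AV; split; first by rewrite /Defs.symmetric linearB/= Vsym trmx_mul trmxK.
move=> x; rewrite frob_quad mulmxBl frobBl -!frob_quad subr_ge0.
by rewrite quad_form_gram.
Qed.

(** Both vectors are images of the same noise, so the stacked vector is the image under [col_mx A B]
    and is jointly Gaussian, possibly degenerate. *)
Lemma gaussian_holder_mulmx p (V : 'M[R]_p) (kappa gamma : R) f
    (A B : 'M[R]_(p, N)) : gaussian_holder V kappa gamma f ->
    loewner_le (A *m A^T) V -> loewner_le (B *m B^T) V ->
  ('E_P[fun w => ((f (A *m gvec g w) - f (B *m gvec g w)) ^+ 2)%R] <=
   (kappa ^+ 2 * frob (A - B) (A - B) `^ gamma)%:E)%E.
Proof.
move=> fH AV BV.
have := fH _ _ P (fun w => A *m gvec g w) (fun w => B *m gvec g w).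
have -> : (fun w => col_mx (A *m gvec g w) (B *m gvec g w)) =
    (fun w => col_mx A B *m gvec g w) by apply/funext => w; rewrite mul_col_mx.
have -> : (fun w => euclidean_norm (A *m gvec g w - B *m gvec g w) ^+ 2) =
    (fun w => euclidean_norm ((A - B) *m gvec g w) ^+ 2).
  by apply/funext => w; rewrite mulmxBl.
rewrite !Cov_mulmx expectation_sqr_norm poweR_EFin -EFinM.
apply=> //; first exact: gaussian_vector_mulmx.
by move=> i; exact: expectation_mulmx_gvec.
Qed.

End gaussian_images.

(** * Splitting expectations over the words of draws *)

Section conditioning.
Context {R : realType} d (T : measurableType d) (P : probability T R) (n : nat).
Context (e : int -> T -> 'cV[R]_n) (g : int -> T -> R).
Hypothesis n_gt0 : (0 < n)%N.
Hypothesis e_g : driving_sequences P e g.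
Implicit Types (s : seq 'I_n) (b : int).

(* A word lists the basis vectors drawn from time [b] on, the latest first. *)
Fixpoint word_event b s : set T :=
  if s is j :: s' then
    word_event b s' `&` e (b + (size s')%:Z) @^-1` [set delta_mx j 0]
  else setT.

Lemma measurable_set1_vec (v : 'cV[R]_n) : measurable ([set v] : set (borel_vec R n)).
Proof.
have -> : [set v] = \bigcap_(i in [set: 'I_n]) (fun u : 'cV[R]_n => u i 0) @^-1` [set v i 0].
  apply/seteqP; split => [u -> //|u uv].
  by apply/matrixP => i j; rewrite ord1; exact: uv.
apply: fin_bigcap_measurable; first exact: finite_finset.
move=> i _; rewrite -[X in measurable X]setTI.
by apply: measurable_coord => //; exact: measurable_set1.
Qed.

Lemma word_event_sigma b s :
  sigma_generated (e : int -> T -> borel_vec R n) (word_event b s).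
Proof.
pose G := [set A | exists (i : int) (B : set (borel_vec R n)),
  measurable B /\ A = e i @^-1` B].
elim: s => [|j s IH]; first exact: (@measurableT _ (g_sigma_algebraType G)).
apply: (@measurableI _ (g_sigma_algebraType G)) => //.
apply: sub_sigma_algebra; exists (b + (size s)%:Z), [set delta_mx j 0].
by split => //; exact: measurable_set1_vec.
Qed.

Let me i : measurable_fun setT (e i : T -> borel_vec R n).
Proof. exact: e_random e_g i. Qed.

Let mE i j : measurable (e i @^-1` [set delta_mx j 0]).
Proof.
rewrite -[X in measurable X]setTI; apply: me => //; exact: measurable_set1_vec.
Qed.

Lemma measurable_word_event b s : measurable (word_event b s).
Proof. by elim: s => [|j s IH] //=; exact: measurableI. Qed.

Local Open Scope ereal_scope.

(** The later times [r] carry the induction: the head letter of the word is moved into [r] as one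
    more constraint. *)
Lemma prob_word_event_cap b s (r : seq int) (B : int -> set (borel_vec R n)) :
    uniq r -> (forall i, i \in r -> (b + (size s)%:Z <= i)%R) ->
    (forall i, measurable (B i)) ->
  P (word_event b s `&` \bigcap_(i in [set` r]) (e i @^-1` B i)) =
  (n%:R^-1 ^+ size s)%R%:E * \prod_(i <- r) P (e i @^-1` B i).
Proof.
elim: s r B => [|j s IH] r B ur br mB.
  by rewrite setTI expr0 mul1e; exact: (e_independent e_g).
pose k := (b + (size s)%:Z)%R.
pose B' i := if i == k then [set delta_mx j 0%R] else B i.
have kr : k \notin r by apply/negP => /br /=; rewrite /k; lia.
have B'k : B' k = [set delta_mx j 0%R] by rewrite /B' eqxx.
have B'r i : i \in r -> B' i = B i.
  by rewrite /B'; case: eqP => // -> ir; rewrite ir in kr.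
have := IH (k :: r) B'; rewrite big_cons bigcap_seq_cons B'k.
have -> : \prod_(i <- r) P (e i @^-1` B' i) = \prod_(i <- r) P (e i @^-1` B i).
  by rewrite big_seq [RHS]big_seq; apply: eq_bigr => i /B'r ->.
have -> : \bigcap_(i in [set` r]) (e i @^-1` B' i) = \bigcap_(i in [set` r]) (e i @^-1` B i).
  by apply: eq_bigcapr => i /= /B'r ->.
rewrite /= setIA => -> //.
- have -> : P (e k @^-1` [set delta_mx j 0%R]) = (n%:R^-1)%:E by exact: (e_uniform e_g).
  by rewrite muleA -EFinM -exprSr.
- by rewrite /= kr.
- move=> i; rewrite in_cons => /predU1P[->//|/br /=]; rewrite /k; lia.
- by move=> i; rewrite /B'; case: eqP => // _; exact: measurable_set1_vec.
Qed.

Lemma prob_word_event b s : P (word_event b s) = (n%:R^-1 ^+ size s)%R%:E.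
Proof.
have := @prob_word_event_cap b s [::] (fun=> setT).
by rewrite big_nil mule1 set_nil bigcap_set0 setIT; apply.
Qed.

(** A draw is a basis vector only almost surely: the [n] disjoint events have total probability n *
    (1 / n) = 1, and what they miss is a null set. *)
Lemma integral_word_event_cons b s (F : T -> \bar R) :
    measurable_fun setT F -> (forall w, 0 <= F w) ->
  \int[P]_(w in word_event b s) F w =
  \sum_j \int[P]_(w in word_event b (j :: s)) F w.
Proof.
move=> mF F0; set W := word_event b s.
pose E j := e (b + (size s)%:Z)%R @^-1` [set delta_mx j 0%R].
have mW : measurable W by exact: measurable_word_event.
have Edisj j k w : E j w -> E k w -> j = k.
  move=> wj wk; have /matrixP/(_ j 0%R) : delta_mx j 0%R = delta_mx k 0%R :> 'cV[R]_n.
    by rewrite -wj -wk.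
  rewrite !mxE !eqxx/= andbT; case: eqP => [->//|_ /eqP].
  by rewrite oner_eq0.
pose U := \big[setU/set0]_j E j.
have mU : measurable U by apply: bigsetU_measurable => j _; exact: mE.
have PU : P U = 1.
  rewrite /U measure_bigsetU_ord; [|by move=> j; exact: mE|]; last first.
    by move=> j k _ _ [w [wj wk]]; exact: Edisj wj wk.
  rewrite (eq_bigr (fun=> (n%:R^-1)%:E)); last first.
    by move=> j _; exact: (e_uniform e_g).
  rewrite sumEFin sumr_const card_ord -[(_ *+ n)%R]mulr_natl divff//.
  by rewrite pnatr_eq0 -lt0n.
have WU : W `&` U = \big[setU/set0]_j (W `&` E j).
  by rewrite /U big_distrr.
have -> : \int[P]_(w in W) F w = \int[P]_(w in W `&` U) F w.
  rewrite -{1}(setUIDK W U) ge0_integral_setU//.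
  - rewrite [X in _ + X]null_set_integral ?adde0//.
    + exact: measurableD.
    + exact: measurable_funTS.
    + have PUC : P (~` U) = 0 by rewrite probability_setC// PU subee.
      apply: (subset_measure0 _ _ _ PUC); last by move=> w [].
        exact: measurableD.
      exact: measurableC.
  - exact: measurableI.
  - exact: measurableD.
  - exact: measurable_funTS.
  - by apply/disj_setPS => w [[_ Uw] [_]].
rewrite WU ge0_integral_bigsetU//.
- by move=> j; apply: measurableI => //; exact: mE.
- exact: index_enum_uniq.
- by move=> j k _ _ [w [[_ wj] [_ wk]]]; exact: Edisj wj wk.
- exact: measurable_funTS.
Qed.

Lemma integral_word_event b k (F : T -> \bar R) :
    measurable_fun setT F -> (forall w, 0 <= F w) ->
  \int[P]_w F w = \sum_(s <- words n k) \int[P]_(w in word_event b s) F w.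
Proof.
move=> mF F0; elim: k => [|k IH]; first by rewrite big_seq1.
rewrite IH big_words exchange_big/=; apply: eq_bigr => s _.
exact: integral_word_event_cons.
Qed.

Lemma integral_word_event_indep b s (Y : T -> R) :
    measurable_fun setT Y -> (forall w, 0 <= Y w)%R ->
    (forall B, measurable B -> sigma_generated g (Y @^-1` B)) ->
  \int[P]_(w in word_event b s) (Y w)%:E =
  (n%:R^-1 ^+ size s)%R%:E * \int[P]_w (Y w)%:E.
Proof.
move=> mY Y0 gY; rewrite -(prob_word_event b s).
apply: ge0_integral_indep => //; first exact: measurable_word_event.
move=> B mB; apply: (e_g_independent e_g); [exact: word_event_sigma|exact: gY].
Qed.

Lemma sigma_generated_diff_sqr N (h : 'I_N -> int) p (A B : 'M[R]_(p, N)) f C :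
    borel_function f -> measurable C ->
  sigma_generated g ((fun w => (f (A *m gvec (g \o h) w) -
    f (B *m gvec (g \o h) w)) ^+ 2)%R @^-1` C).
Proof.
move=> mf mC.
pose G := [set A | exists (i : int) (B : set R), measurable B /\ A = g i @^-1` B].
(* Measurability is proved again with [T] carrying only the sigma-algebra generated by [g]. *)
pose T' := g_sigma_algebraType G.
have mg i : measurable_fun [set: T'] (g (h i) : T' -> R).
  by move=> _ D mD; rewrite setTI; apply: sub_sigma_algebra; exists (h i), D.
have mF := measurable_diff_sqr mf
  (random_vector_mulmx_gvec (g := fun i => g (h i) : T' -> R) A mg)
  (random_vector_mulmx_gvec (g := fun i => g (h i) : T' -> R) B mg).
by have := mF measurableT C mC; rewrite setTI.
Qed.

Local Close Scope ereal_scope.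

Lemma measurable_chain_from (V : 'M[R]_n) b k : random_vector (chain_from V e g b k).
Proof.
have mg i : measurable_fun setT (g i) by have [] := g_standard e_g i.
have /= mec i := (random_vectorP (e i)).1 (me i).
elim: k => [|k /random_vectorP IH]; first by apply/random_vectorP => i; exact: measurable_cst.
apply/random_vectorP => i /=; under eq_fun do rewrite !mxE.
apply: measurable_funD; first exact: IH.
apply: measurable_funM.
  apply: measurable_funB => //; apply: measurable_sum => j.
  under eq_fun do rewrite mxE.
  by apply: measurable_funM; [exact: mec|exact: IH].
by apply: measurable_sum => j; apply: measurable_funM => //; exact: mec.
Qed.

(** One noise block starting at time [b] serves every starting time b + m, the delay being absorbed
    in [coef]. The step matches because S v_j = V e_j and e_j^T S = v_j^T. *)
Lemma chain_fromE N (S : 'M[R]_n) b m s w :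
    word_event b s w -> (size s <= N)%N -> (m <= size s)%N ->
  chain_from (S *m S^T) e g (b + m%:Z) (size s - m) w =
  S *m (coef N S m s *m gvec (fun i : 'I_N => g (b + (i : nat)%:Z)) w).
Proof.
elim: s => [|j s IH]; first by move=> _ _ _; rewrite /= mul0mx mulmx0.
move=> [ws /= ew] sN; rewrite leq_eqVlt => /predU1P[->|ms].
  by rewrite subnn /= ltnSn mul0mx mulmx0.
have {ms}ms : (m <= size s)%N by [].
rewrite subSn//= ltnNge ms/= IH// ?(ltnW sN)//.
set G := gvec _ w; set U := coef N S m s.
have -> : (b + m%:Z + (size s - m)%:Z)%R = b + (size s)%:Z by lia.
rewrite ew.
have tG : tick N (size s) *m G = (g (b + (size s)%:Z) w)%:M.
  apply/matrixP => i k; rewrite !ord1 !mxE eqxx mulr1n (bigD1 (Ordinal sN))//=.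
  rewrite !mxE eqxx mul1r big1 ?addr0// => l lN; rewrite !mxE.
  by case: eqP => [lE|]; [case/eqP: lN; exact: val_inj|rewrite mul0r].
have SE : S *m dir S j = S *m S^T *m delta_mx j 0 by rewrite /dir -lock mulmxA.
have dE : (delta_mx j 0)^T *m (S *m (U *m G)) = (dir S j)^T *m (U *m G).
  by rewrite /dir -lock trmx_mul trmxK !mulmxA.
have -> : (proj S j *m U + dir S j *m tick N (size s)) *m G =
    U *m G - dir S j *m ((dir S j)^T *m (U *m G)) + dir S j *m (tick N (size s) *m G).
  by rewrite mulmxDl projE mulmxBl mul1mx mulmxBl !mulmxA.
have cE (c : 'M[R]_1) : dir S j *m c = c 0 0 *: dir S j.
  by rewrite {1}[c]mx11_scalar mul_mx_scalar.
rewrite tG mulmxDr mulmxBr scalerBl dE cE mul_mx_scalar -!scalemxAr SE.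
by rewrite -!addrA; congr (_ + _); rewrite addrC.
Qed.

End conditioning.

(** * The bounds on the chain and on the sequence nu *)

Section jensen.
Context {R : realType}.

(* Young's inequality for the exponents 1/gamma and 1/(1-gamma). *)
Lemma powR_le_tangent (gamma t x : R) :
    0 < gamma -> gamma <= 1 -> 0 < t -> 0 <= x ->
  x `^ gamma <= t `^ gamma * (gamma * (x / t) + (1 - gamma)).
Proof.
move=> g0 g1 t0 x0; have y0 : 0 <= x / t by rewrite divr_ge0// ltW.
rewrite -{1}(divfK (lt0r_neq0 t0) x) powRM// ?(ltW t0)// mulrC.
rewrite ler_wpM2l ?powR_ge0//.
move: g1; rewrite le_eqVlt => /predU1P[->|g1].
  by rewrite powRr1// mul1r subrr addr0.
have := @conjugate_powR R ((x / t) `^ gamma) 1 gamma^-1 (1 - gamma)^-1.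
rewrite powR_ge0 ler01 !invr_gt0 g0 subr_gt0 g1 !invrK addrC subrK.
rewrite -powRrM mulfV ?lt0r_neq0// powRr1// powR1 mul1r mulr1 (mulrC _ gamma).
by apply.
Qed.

Lemma mean_powR n (gamma : R) k (F : seq 'I_n -> R) :
    (0 < n)%N -> 0 < gamma -> gamma <= 1 -> (forall s, 0 <= F s) ->
  mean k (fun s => F s `^ gamma : R^o) <= (mean k (F : seq 'I_n -> R^o)) `^ gamma :> R.
Proof.
move=> n0 g0 g1 F0; set M := mean k (F : seq 'I_n -> R^o).
have : 0 <= M by rewrite mulr_ge0 ?exprn_ge0 ?invr_ge0 ?sumr_ge0.
(* Jensen follows by averaging the tangent at the mean. There is no tangent at 0; in that case every
   term is 0, and so is its power since gamma > 0. *)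
rewrite le_eqVlt => /predU1P[M0|M0].
  have /eqP : \sum_(s <- words n k) F s = 0.
    apply/eqP; move/eqP: M0; rewrite eq_sym mulf_eq0 => /orP[|//].
    by rewrite expf_eq0 invr_eq0 pnatr_eq0 eqn0Ngt n0 andbF.
  rewrite psumr_eq0// => /allP Fs0.
  rewrite /mean big1_seq ?scaler0 ?powR_ge0// => s /Fs0/eqP->.
  by rewrite powR0// lt0r_neq0.
apply: (@le_trans _ _ (mean k (fun s =>
    M `^ gamma * (gamma * (F s / M) + (1 - gamma)) : R^o))).
  by apply: ler_mean => s _; exact: powR_le_tangent.
rewrite -meanZ meanD mean_cst// -meanZ.
rewrite [X in gamma * X](_ : _ = M^-1 * M); last first.
  by rewrite meanZ; apply: eq_mean => s _; rewrite mulrC.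
by rewrite mulVf ?lt0r_neq0// mulr1 addrCA subrr addr0 mulr1.
Qed.

End jensen.

Lemma mutually_independent_comp d (T : measurableType d) (R : realType)
    (P : probability T R) (I : eqType) (J : finType) d' (E : measurableType d')
    (X : I -> T -> E) (h : J -> I) :
  injective h -> mutually_independent P X ->
  mutually_independent P (fun j => X (h j)).
Proof.
move=> hI XI s B us mB.
(* Times outside the image of [h] receive the trivial event. *)
pose C i := if [pick j | h j == i] is Some j then B j else setT.
have Ch j : C (h j) = B j.
  by rewrite /C; case: pickP => [k /eqP/hI->//|/(_ j)]; rewrite eqxx.
have mC i : measurable (C i) by rewrite /C; case: pickP.
have := XI (map h s) C; rewrite map_inj_uniq// => /(_ us mC).
rewrite big_map; under eq_bigr do rewrite Ch.
move=> <-; congr (P _); apply/seteqP; split => w /=.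
  by move=> wB _ /= /mapP[j js ->]; rewrite /preimage/= Ch; exact: wB.
move=> wC j js; have := wC (h j) (map_f h js).
by rewrite /preimage/= Ch.
Qed.

(** * From the bound for each word to the chain *)

Section holder_chain.
Context {R : realType} d (T : measurableType d) (P : probability T R) (n : nat).
Context (e : int -> T -> 'cV[R]_n) (g : int -> T -> R).
Hypothesis n_gt0 : (0 < n)%N.
Hypothesis e_g : driving_sequences P e g.
Variables (S : 'M[R]_n) (kappa gamma : R) (f : 'cV[R]_n -> R).
Hypothesis S_row : forall j, (S *m S^T) j j = 1.
Hypotheses (gamma_gt0 : 0 < gamma) (gamma_le1 : gamma <= 1).
Hypothesis f_borel : borel_function f.
Hypothesis f_holder : gaussian_holder (S *m S^T) kappa gamma f.

Lemma loewner_le_coef N m s : (size s <= N)%N ->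
  loewner_le (S *m coef N S m s *m (S *m coef N S m s)^T) (S *m S^T).
Proof.
move=> sN; apply: loewner_le_gram; first by rewrite trmx_mul trmxK.
move=> x; rewrite trmx_mul -mulmxA quad_form_gram.
exact: coef_le1.
Qed.

Lemma expectation_holder_coef N b m s : (size s <= N)%N ->
  ('E_P[fun w => let G := gvec (fun i : 'I_N => g (b + (i : nat)%:Z)) w in
     ((f (S *m coef N S 0 s *m G) - f (S *m coef N S m s *m G)) ^+ 2)%R] <=
   (kappa ^+ 2 * frob (S *m dcoef N S m s) (S *m dcoef N S m s) `^ gamma)%:E)%E.
Proof.
move=> sN; rewrite /dcoef mulmxBr; apply: gaussian_holder_mulmx f_holder _ _.
- by move=> i; exact: g_standard e_g _.
- apply: mutually_independent_comp (g_independent e_g) => i j ij.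
  by apply: val_inj; move/addrI: ij => [].
- exact: loewner_le_coef.
- exact: loewner_le_coef.
Qed.

Lemma expectation_holder_chain i m :
  ('E_P[fun w => ((f (shifted_chain (S *m S^T) e g i m w) -
     f (chain (S *m S^T) e g i w)) ^+ 2)%R] <=
   (kappa ^+ 2 * dsq (i + m) S m i `^ gamma)%:E)%E.
Proof.
(* The draws and the noise that determine both chains at time [i] are those of times -m to i - 1. *)
pose N := (i + m)%N; pose b : int := - m%:Z.
pose G := gvec (fun i : 'I_N => g (b + (i : nat)%:Z)).
pose Y s w := (f (S *m coef N S 0 s *m G w) - f (S *m coef N S m s *m G w)) ^+ 2.
have mg (j : 'I_N) : measurable_fun setT (g (b + (j : nat)%:Z)).
  by have [] := g_standard e_g (b + (j : nat)%:Z).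
have mY s : measurable_fun setT (Y s).
  apply: measurable_diff_sqr f_borel _ _.
    exact: random_vector_mulmx_gvec.
  exact: random_vector_mulmx_gvec.
rewrite unlock (integral_word_event n_gt0 e_g b N); last 2 first.
- apply/measurable_EFinP; apply: measurable_diff_sqr f_borel _ _.
    exact: measurable_chain_from e_g _ _ _.
  exact: measurable_chain_from e_g _ _ _.
- by move=> w; rewrite lee_fin sqr_ge0.
apply: (@le_trans _ _ (\sum_(s <- words n N) (n%:R^-1 ^+ N * (kappa ^+ 2 *
    frob (S *m dcoef N S m s) (S *m dcoef N S m s) `^ gamma))%:E)%E).
  rewrite big_seq [leRHS]big_seq; apply: lee_sum => s /size_words sN.
  rewrite (eq_integral (fun w => (Y s w)%:E)).
    rewrite (integral_word_event_indep n_gt0 e_g)//.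
    - rewrite sN EFinM lee_wpmul2l// ?lee_fin ?exprn_ge0 ?invr_ge0//.
      have := @expectation_holder_coef N b m s; rewrite sN unlock; exact.
    - by move=> w; rewrite sqr_ge0.
    - move=> B mB.
      have := @sigma_generated_diff_sqr _ _ _ g N (fun i : 'I_N => b + (i : nat)%:Z) _
        (S *m coef N S 0 s) (S *m coef N S m s) _ _ f_borel mB.
      exact.
  move=> w; rewrite inE => ws; rewrite /Y; congr ((_ - _) ^+ 2)%:E.
  - have := @chain_fromE _ _ _ _ _ g n_gt0 N S b 0 s w ws.
    by rewrite sN addr0 subn0 /shifted_chain mulmxA => ->.
  - have := @chain_fromE _ _ _ _ _ g n_gt0 N S b m s w ws.
    by rewrite sN addNr addnK /chain mulmxA leq_addl => ->.
(* The sum is now a mean over words of gamma-th powers, to which Jensen applies. *)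
rewrite sumEFin lee_fin -mulr_sumr -mulr_sumr mulrCA ler_wpM2l ?sqr_ge0//.
rewrite dsq_mean; apply: mean_powR => // s; exact: frob_ge0.
Qed.

End holder_chain.

(** * Monotonicity and summability of nu *)

Section nu_bound.
Context {R : realType} (n : nat) (lmax lmin kappa gamma : R).
Hypothesis n_gt0 : (0 < n)%N.
Hypotheses (kappa_gt0 : 0 < kappa) (gamma_gt0 : 0 < gamma).
Hypotheses (lmin_gt0 : 0 < lmin) (lmin_le1 : lmin <= 1) (lmin_lmax : lmin <= lmax).

Let r := 1 - lmin / n%:R.
Let nR0 : 0 < n%:R :> R. Proof. by rewrite ltr0n. Qed.
Let lmax_gt0 : 0 < lmax. Proof. exact: lt_le_trans lmin_lmax. Qed.

Let r_lt1 : r < 1.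
Proof. by rewrite gtrBl divr_gt0. Qed.

Let r_ge0 : 0 <= r.
Proof.
by rewrite subr_ge0 ler_pdivrMr// mul1r (le_trans lmin_le1)// ler1n.
Qed.

Let r_gt0 : (1 < n)%N -> 0 < r.
Proof.
by move=> n1; rewrite subr_gt0 ltr_pdivrMr// mul1r (le_lt_trans lmin_le1)// ltr1n.
Qed.

(** The power is monotone, so the minimum can be taken before it; both bounds on q_i then apply
    under a single power. *)
Lemma nu_boundE i : nu_bound n lmax lmin kappa gamma i =
  kappa ^+ 2 * (Num.min (lmax * n%:R * r ^+ i) (n%:R ^+ 2 / i.+1%:R)) `^ gamma.
Proof.
have a0 : 0 <= lmax * n%:R by rewrite mulr_ge0 ?ltW.
have ab : (lmax * n%:R) `^ gamma * r `^ (gamma * i%:R) =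
    (lmax * n%:R * r ^+ i) `^ gamma.
  by rewrite [RHS]powRM ?exprn_ge0// [gamma * _]mulrC powRrM powR_mulrn.
have c0 : 0 <= n%:R ^+ 2 / i.+1%:R :> R by rewrite divr_ge0.
have b0 : 0 <= lmax * n%:R * r ^+ i by rewrite mulr_ge0 ?exprn_ge0.
rewrite /nu_bound -/r ab; congr (_ * _).
have [bc|cb] := leP (lmax * n%:R * r ^+ i) (n%:R ^+ 2 / i.+1%:R).
  by rewrite min_l// ge0_ler_powR ?nnegrE// ltW.
by rewrite min_r// ge0_ler_powR ?nnegrE// ltW.
Qed.

Let base_ge0 i : 0 <= Num.min (lmax * n%:R * r ^+ i) (n%:R ^+ 2 / i.+1%:R).
Proof.
by rewrite le_min divr_ge0// mulr_ge0 ?exprn_ge0// mulr_ge0 ?ltW.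
Qed.

Lemma nu_bound_ge0 i : 0 <= nu_bound n lmax lmin kappa gamma i.
Proof. by rewrite nu_boundE mulr_ge0 ?sqr_ge0 ?powR_ge0. Qed.

Lemma le_nu_bound i x : 0 <= x ->
    x <= lmax * n%:R * r ^+ i -> x <= n%:R ^+ 2 / i.+1%:R ->
  kappa ^+ 2 * x `^ gamma <= nu_bound n lmax lmin kappa gamma i.
Proof.
move=> x0 x1 x2; rewrite nu_boundE ler_wpM2l ?sqr_ge0//.
rewrite ge0_ler_powR ?nnegrE ?base_ge0 ?(ltW gamma_gt0)//.
by rewrite le_min x1.
Qed.

Lemma nu_bound_nonincreasing : nonincreasing_seq (nu_bound n lmax lmin kappa gamma).
Proof.
apply/nonincreasing_seqP => i; rewrite !nu_boundE ler_wpM2l ?sqr_ge0//.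
rewrite ge0_ler_powR ?nnegrE ?base_ge0 ?(ltW gamma_gt0)// le_min !ge_min; apply/andP; split.
  by rewrite exprS ler_wpM2l ?ler_piMl ?exprn_ge0 ?(ltW r_lt1)// ?mulr_ge0 ?(ltW lmax_gt0).
by rewrite ler_wpM2l ?sqr_ge0 ?orbT// lef_pV2 ?posrE// ler_nat.
Qed.

Lemma nu_bound_gt0 i : (1 < n)%N -> 0 < nu_bound n lmax lmin kappa gamma i.
Proof.
move=> n1; rewrite nu_boundE mulr_gt0 ?exprn_gt0 ?powR_gt0//.
by rewrite lt_min divr_gt0 ?exprn_gt0// !mulr_gt0// exprn_gt0 ?r_gt0.
Qed.

Lemma nu_bound_decreasing : (1 < n)%N ->
  decreasing_seq (nu_bound n lmax lmin kappa gamma).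
Proof.
move=> n1; apply/decreasing_seqP => i; rewrite !nu_boundE ltr_pM2l ?exprn_gt0//.
rewrite gt0_ltr_powR// ?nnegrE// lt_min !gt_min; apply/andP; split.
  by rewrite ltr_pM2l ?mulr_gt0// exprS gtr_pMl ?r_lt1// exprn_gt0 ?r_gt0.
by rewrite ltr_pM2l ?exprn_gt0// ltf_pV2 ?posrE// ltr_nat ltnS leqnn orbT.
Qed.

(** The geometric term of the minimum is enough: dropping the factor 1 / (i + 1) leaves a geometric
    series of ratio r^(gamma / 2) < 1. *)
Lemma nu_bound_summable : A1_summable (nu_bound n lmax lmin kappa gamma).
Proof.
pose c := Num.sqrt (kappa ^+ 2 * (lmax * n%:R) `^ gamma).
pose q := Num.sqrt (r `^ gamma).
have q0 : 0 <= q by rewrite sqrtr_ge0.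
have q1 : q < 1.
  have := gt0_ltr_powR gamma_gt0 r_ge0 ler01 r_lt1.
  by rewrite powR1 -{2}sqrtr1 ltr_sqrt.
have nuq i : Num.sqrt (nu_bound n lmax lmin kappa gamma i / i.+1%:R) <= geometric c q i.
  rewrite -[leRHS]ger0_norm ?mulr_ge0 ?exprn_ge0 ?sqrtr_ge0// -sqrtr_sqr.
  rewrite exprMn exprAC !sqr_sqrtr ?mulr_ge0 ?powR_ge0 ?(ltW kappa_gt0)//.
  rewrite ler_wsqrtr//.
  apply: (@le_trans _ _ (nu_bound n lmax lmin kappa gamma i)).
    by rewrite ler_pdivrMr// ler_peMr ?nu_bound_ge0// ler1n.
  rewrite /nu_bound -[leRHS]mulrA ler_wpM2l ?sqr_ge0// ge_min -/r powRrM powR_mulrn ?powR_ge0//.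
  by rewrite lexx.
rewrite /A1_summable.
apply: (@le_lt_trans _ _ (\sum_(0 <= i <oo) (geometric c q i)%:E)%E).
  by apply: lee_nneseries => i _; rewrite lee_fin ?sqrtr_ge0.
have cg : cvgn (series (geometric c q)).
  by apply: is_cvg_geometric_series; rewrite ger0_norm.
rewrite (_ : (fun k => _) = EFin \o series (geometric c q)); last first.
  by apply/funext => k /=; rewrite /series/= sumEFin.
by rewrite EFin_lim// ltry.
Qed.

End nu_bound.

Theorem theorem4p1 (R : realType) (n : nat) (V : 'M[R]_n) (lmax lmin : R)
    (kappa gamma : R) (f : 'cV[R]_n -> R)
    (d : measure_display) (T : measurableType d) (P : probability T R)
    (e : int -> T -> 'cV[R]_n) (g : int -> T -> R)
    (V_posdef : positive_definite V)
    (V_diag : forall k : 'I_n, V k k = 1)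
    (V_lmax : largest_eigenvalue V lmax)
    (V_lmin : smallest_eigenvalue V lmin)
    (kappa_gt0 : 0 < kappa) (gamma_gt0 : 0 < gamma) (gamma_le1 : gamma <= 1)
    (f_borel : borel_function f)
    (f_holder : gaussian_holder V kappa gamma f)
    (e_g : driving_sequences P e g) :
  let nu := nu_bound n lmax lmin kappa gamma in
  ((1 < n)%N ->
     assumption_A1 P f (chain V e g) (shifted_chain V e g) nu) /\
  (n = 1%N ->
     weak_assumption_A1 P f (chain V e g) (shifted_chain V e g) nu).
Proof.
(* The two readings of A1 share the bound on expectations; the dimension matters only for the
   strictness of positivity and monotonicity. *)
move=> nu; suff H : (0 < n)%N -> [/\ 0 < lmin, lmin <= 1, lmin <= lmax &
    A1_bound P f (chain V e g) (shifted_chain V e g) nu].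
  split => [n1|n1].
    have n0 := ltnW n1; have [l0 l1 ll b] := H n0; split => //.
    - by move=> i; exact: nu_bound_gt0.
    - exact: nu_bound_decreasing.
    - exact: nu_bound_summable.
  have n0 : (0 < n)%N by rewrite n1.
  have [l0 l1 ll b] := H n0; split => //.
  - by move=> i; exact: nu_bound_ge0.
  - exact: nu_bound_nonincreasing.
  - exact: nu_bound_summable.
move=> n0; have [S VS] := cholesky V_posdef; subst V.
have Su := positive_definite_gram_unit V_posdef.
have l0 := smallest_eigenvalue_gt0 Su V_lmin.
have l1 := smallest_eigenvalue_le1 n0 V_diag V_lmin.
have ll : lmin <= lmax by apply: V_lmax.2; exact: V_lmin.1.
split => // i m.
have := expectation_holder_chain n0 e_g V_diag gamma_gt0 gamma_le1 f_borel f_holder i m.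
move=> /le_trans; apply.
rewrite lee_fin; apply: le_nu_bound => //.
- rewrite dsq_mean mulr_ge0 ?exprn_ge0 ?invr_ge0// sumr_ge0// => s _.
  exact: frob_ge0.
- by apply: dsq_le_geom => //; exact: leq_addl.
- by apply: dsq_le_inv => //; exact: leq_addl.
Qed.
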